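(* Let $A, B$ be rearrangement-invariant Banach function spaces over a resonant measure space $(\mathcal{R}, \mu)$, and let $\lVert \cdot \rVert_{\overline{A}}$, $\lVert \cdot \rVert_{\overline{B}}$ be the canonical representation norms (over $([0,\infty),\lambda)$) of $\lVert\cdot\rVert_A$, $\lVert\cdot\rVert_B$. Then for every $f \in \mathcal{M}(\mathcal{R}, \mu)$ $$\lVert f \rVert_{A+B} = \lVert f^* \rVert_{\overline{A} + \overline{B}}.$$
   Context: A measure space is resonant if it is $\sigma$-finite and either non-atomic or completely atomic with all atoms of the same measure $\beta\in(0,\infty)$. $\lambda$ is Lebesgue measure on $[0,\infty)$. $\mathcal{M}(\mathcal{R},\mu)$ is the set of ($\mu$-a.e. equivalence classes of) measurable functions on $\mathcal{R}$ (infinite values are allowed), and $\mathcal{M}_+$ its cone of non-negative functions. The non-increasing rearrangement of $f$ is $f^*(t)=\inf\{s\ge 0:\ \mu(\{|f|>s\})\le t\}$, $t\in[0,\infty)$. An r.i. Banach function norm is a functional $\lVert\cdot\rVert:\mathcal{M}(\mathcal{R},\mu)\to[0,\infty]$ with $\lVert\,|f|\,\rVert=\lVert f\rVert$ such that: (norm) $\lVert af\rVert=|a|\lVert f\rVert$ for $a\in\mathbb{C}$, $f\in\mathcal{M}_+$, $\lVert f\rVert=0\Leftrightarrow f=0$ a.e., and $\lVert f+g\rVert\le \lVert f\rVert+\lVert g\rVert$ for all $f,g\in\mathcal{M}_+$; (lattice property) $0\le f\le g$ a.e. implies $\lVert f\rVert\le\lVert g\rVert$; (Fatou property) $0\le f_n\uparrow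 f$ a.e. implies $\lVert f_n\rVert\uparrow\lVert f\rVert$; $\lVert\chi_E\rVert<\infty$ whenever $\mu(E)<\infty$; for every $E$ with $\mu(E)<\infty$ there is $C_E<\infty$ with $\int_E f\,d\mu\le C_E\lVert f\rVert$ for all $f\in\mathcal{M}_+$; (rearrangement-invariance) $\lVert f\rVert=\lVert g\rVert$ whenever $f^*=g^*$. The corresponding r.i. Banach function space is $X=\{f\in\mathcal{M}(\mathcal{R},\mu):\lVert f\rVert_X<\infty\}$. Sum: $A+B=\{f: \exists f_A\in A, f_B\in B,\ f=f_A+f_B\}$ and $\lVert f\rVert_{A+B}=\inf\{\lVert f_A\rVert_A+\lVert f_B\rVert_B:\ f=f_A+f_B,\ f_A\in A,\ f_B\in B\}$ (with $\inf\emptyset=\infty$). Canonical representation norm of $X$: for $g\in\mathcal{M}([0,\infty),\lambda)$ put $\lVert g\rVert_{\overline{X}}=\lVert \widetilde g\rVert_X$, where $\widetilde g\in\mathcal{M}(\mathcal{R},\mu)$ is: if $(\mathcal{R},\mu)$ is non-atomic, $\widetilde g=(g^*\chi_{[0,\mu(\mathcal{R}))})\circ\sigma$ with $\sigma:\mathcal{R}\to[0,\mu(\mathcal{R}))$ a fixed measure-preserving map; if $(\mathcal{R},\mu)$ is completely atomic with atoms $e_n$ ($n=0,1,2,\dots$, $(n+1)\beta\le\mu(\mathcal{R})$) of measure $\beta$, $\widetilde g(e_n)=\frac1\beta\int_{n\beta}^{(n+1)\beta}g^*\,d\lambda$. This does not depend on the choice of $\sigma$ or the enumeration, it is an r.i.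 Banach function norm over $([0,\infty),\lambda)$, and $\lVert f\rVert_X=\lVert f^*\rVert_{\overline{X}}$ for all $f\in\mathcal{M}(\mathcal{R},\mu)$. It coincides with the norm of the classical Luxemburg construction, $\lVert g\rVert_{\overline{X}}=\sup\{\int_0^\infty g^*h^*\,d\lambda:\ h\in\mathcal{M}(\mathcal{R},\mu),\ \lVert h\rVert_{X'}\le1\}$, where $\lVert h\rVert_{X'}=\sup\{\int_{\mathcal{R}}|fh|\,d\mu:\ \lVert f\rVert_X\le1\}$. $\overline{X}$ denotes the corresponding space. *)

(* Defs.v *)
From HB Require Import structures.
From mathcomp Require Import all_boot all_order all_algebra.
From mathcomp Require Import complex.
From mathcomp Require Import all_classical all_reals all_analysis.
From mathcomp Require Import measurable_realfun.

Set Implicit Arguments.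
Unset Strict Implicit.
Unset Printing Implicit Defensive.

Import Order.TTheory GRing.Theory Num.Theory.
Import numFieldNormedType.Exports.

Local Open Scope classical_set_scope.
Local Open Scope ring_scope.

(* Extended complex numbers: [None] is the infinite value.  It absorbs sums,
   and [0 * oo = 0] as in [\bar R]. *)
Definition xcomplex (R : realType) : Type := option R[i].

Definition xfin (R : realType) (z : xcomplex R) : R[i] := odflt 0 z.

Definition xadd (R : realType) (z w : xcomplex R) : xcomplex R :=
  match z, w with
  | Some a, Some b => Some (a + b)
  | _, _ => None
  end.

Definition xscale (R : realType) (a : R[i]) (z : xcomplex R) : xcomplex R :=
  if z is Some b then Some (a * b) else if a == 0 then Some 0 else None.

Definition xmod (R : realType) (z : xcomplex R) : \bar R :=
  if z is Some a then (ComplexField.Normc.normc a)%:E else +oo%E.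

(* The inclusion of [0, +oo] in the extended complex numbers (only meant for
   non-negative arguments). *)
Definition xcomplex_of_ereal (R : realType) (r : \bar R) : xcomplex R :=
  if r is EFin s then Some (Complex s 0) else None.

(* Functions are represented by plain functions [T -> xcomplex R] that satisfy
   [xmeasurable]; equality of their classes is equality mu-a.e.  Elements of
   the cone of non-negative functions are represented by non-negative
   measurable functions [u : T -> \bar R] and enter a norm through
   [of_nneg u]. *)
Section functions.
Context d (T : measurableType d) (R : realType).

(* Borel measurability for the one-point compactification of the plane. *)
Definition xmeasurable (f : T -> xcomplex R) : Prop :=
  [/\ measurable [set x | f x = None],
      measurable_fun setT (fun x => complex.Re (xfin (f x))) &
      measurable_fun setT (fun x => complex.Im (xfin (f x)))].

Definition of_nneg (u : T -> \bar R) : T -> xcomplex R :=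
  fun x => xcomplex_of_ereal (u x).

Definition nneg_measurable (u : T -> \bar R) : Prop :=
  measurable_fun setT u /\ (forall x, 0 <= u x)%E.

End functions.

Section resonant.
Context d (T : measurableType d) (R : realType)
  (mu : {measure set T -> \bar R}).

Definition atom (E : set T) : Prop :=
  [/\ measurable E, (0 < mu E)%E &
      forall F, measurable F -> F `<=` E -> mu F = 0%E \/ mu (E `\` F) = 0%E].

Definition nonatomic : Prop := forall E, ~ atom E.

Definition completely_atomic : Prop :=
  forall E, measurable E -> (0 < mu E)%E -> exists2 F, atom F & F `<=` E.

Definition equal_atoms (beta : R) : Prop :=
  [/\ 0 < beta, completely_atomic & forall E, atom E -> mu E = beta%:E].

Definition resonant : Prop :=
  sigma_finite setT mu /\ (nonatomic \/ exists beta : R, equal_atoms beta).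

End resonant.

(* The measure space ([0, +oo[, Lebesgue): the carrier is [R], and the
   negative half-line is a null set. *)
Definition halfline_measure (R : realType) :
    {measure set (measurableTypeR R) -> \bar R} :=
  mrestr (@lebesgue_measure R) (measurable_itv `[0%R, +oo[).

(* For [t < 0] the infimum is over the empty set, and [rearr mu f t = +oo]. *)
Definition rearr d (T : measurableType d) (R : realType)
    (mu : {measure set T -> \bar R}) (f : T -> xcomplex R) (t : R) : \bar R :=
  ereal_inf [set s%:E | s in
    [set s : R | 0 <= s /\ (mu [set x | s%:E < xmod (f x)] <= t%:E)%E]].

Section norms.
Context d (T : measurableType d) (R : realType)
  (mu : {measure set T -> \bar R}).

Record is_ri_norm (N : (T -> xcomplex R) -> \bar R) : Prop := IsRiNorm {
  ri_ge0 : forall f, xmeasurable f -> (0 <= N f)%E;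
  ri_abs : forall f, xmeasurable f -> N (of_nneg (fun x => xmod (f x))) = N f;
  ri_scale : forall (a : R[i]) u, nneg_measurable u ->
    N (fun x => xscale a (of_nneg u x)) =
      ((ComplexField.Normc.normc a)%:E * N (of_nneg u))%E;
  ri_eq0 : forall u, nneg_measurable u ->
    N (of_nneg u) = 0%E <-> {ae mu, forall x, u x = 0%E};
  ri_triangle : forall u v, nneg_measurable u -> nneg_measurable v ->
    (N (of_nneg (u \+ v)) <= N (of_nneg u) + N (of_nneg v))%E;
  ri_lattice : forall u v, nneg_measurable u -> nneg_measurable v ->
    {ae mu, forall x, (u x <= v x)%E} ->
    (N (of_nneg u) <= N (of_nneg v))%E;
  ri_fatou : forall (u_ : nat -> T -> \bar R) u,
    (forall n, nneg_measurable (u_ n)) -> nneg_measurable u ->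
    {ae mu, forall x, nondecreasing_seq (u_ ^~ x) /\ u_ ^~ x @ \oo --> u x} ->
    nondecreasing_seq (fun n => N (of_nneg (u_ n))) /\
    N (of_nneg (u_ n)) @[n --> \oo] --> N (of_nneg u);
  ri_indic : forall E, measurable E -> (mu E < +oo)%E ->
    (N (of_nneg (fun x => (\1_E x)%:E)) < +oo)%E;
  ri_integral : forall E, measurable E -> (mu E < +oo)%E ->
    exists2 C : R, 0 <= C & forall u, nneg_measurable u ->
      (\int[mu]_(x in E) u x <= C%:E * N (of_nneg u))%E;
  ri_rearr : forall f g, xmeasurable f -> xmeasurable g ->
    (forall t : R, 0 <= t -> rearr mu f t = rearr mu g t) -> N f = N g
}.

Definition ri_space (N : (T -> xcomplex R) -> \bar R) : set (T -> xcomplex R) :=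
  [set f | xmeasurable f /\ (N f < +oo)%E].

Definition sum_norm (NA NB : (T -> xcomplex R) -> \bar R)
    (f : T -> xcomplex R) : \bar R :=
  ereal_inf [set r | exists fA fB,
    [/\ ri_space NA fA, ri_space NB fB,
        {ae mu, forall x, f x = xadd (fA x) (fB x)} &
        r = (NA fA + NB fB)%E]].

Definition itv_total : set R := [set t | 0 <= t /\ (t%:E < mu setT)%E].

(* [sigma] takes its values in [0, mu T[ only a.e., so that such maps also
   exist when [mu] is the zero measure. *)
Definition measure_preserving (sigma : T -> R) : Prop :=
  [/\ measurable_fun setT sigma,
      {ae mu, forall x, itv_total (sigma x)} &
      forall E : set R, measurable E -> E `<=` itv_total ->
        mu (sigma @^-1` E) = lebesgue_measure E].

Definition transfer_nonatomic (sigma : T -> R) (g : R -> xcomplex R)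
    : T -> \bar R :=
  fun x => (rearr (halfline_measure R) g (sigma x) *
            (\1_itv_total (sigma x))%:E)%E.

Definition atom_index (beta : R) (n : nat) : bool :=
  ((n.+1%:R * beta)%:E <= mu setT)%E.

Definition atom_enumeration (beta : R) (e : nat -> set T) : Prop :=
  [/\ forall n, atom_index beta n -> atom mu (e n),
      trivIset (atom_index beta) e &
      mu.-negligible (~` \bigcup_(n in atom_index beta) e n)].

Definition transfer_atomic (beta : R) (e : nat -> set T) (g : R -> xcomplex R)
    : T -> \bar R :=
  fun x => (\sum_(0 <= n <oo | atom_index beta n)
    (beta^-1%:E * \int[halfline_measure R]_(t in `[(n%:R * beta)%R, (n.+1%:R * beta)%R[)
                    (rearr (halfline_measure R) g t)) * (\1_(e n) x)%:E)%E.

(* [Nbar] is the canonical representation norm of [N], built with some choice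
   of the measure-preserving map or of the enumeration of the atoms. *)
Definition is_canonical_norm (N : (T -> xcomplex R) -> \bar R)
    (Nbar : (R -> xcomplex R) -> \bar R) : Prop :=
  (nonatomic mu /\
   exists2 sigma, measure_preserving sigma &
     forall g : measurableTypeR R -> xcomplex R, xmeasurable g ->
       Nbar g = N (of_nneg (transfer_nonatomic sigma g))) \/
  (exists2 beta, equal_atoms mu beta &
   exists2 e, atom_enumeration beta e &
     forall g : measurableTypeR R -> xcomplex R, xmeasurable g ->
       Nbar g = N (of_nneg (transfer_atomic beta e g))).

End norms.

(* Main.v *)
Require Import Defs.
From HB Require Import structures.
From mathcomp Require Import all_boot all_order all_algebra.
From mathcomp Require Import perm complex.
From mathcomp Require Import all_classical all_reals all_analysis.
From mathcomp Require Import measurable_realfun lra zify.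

(* Write [w << u] when the integral of [(w - s)^+] is at most that of
   [(u - s)^+] for every [s >= 0]; the two functions may live on different
   measure spaces.  By the Hardy-Littlewood-Polya principle every r.i. norm,
   together with its canonical representation, is monotone for [<<], so it is
   enough to move decompositions between the two spaces.  Suppose [phi] and
   [psi] are equimeasurable and [phi <= u + v].  On the set where [phi] lies in
   a band [(c^z, c^(z+1)]] replace [u] and [v] by constants [a] and [b] with
   [a + b >= c^z]: the averages of [u] and [v] if the set has finite measure,
   and their essential limsups otherwise.  By Jensen's inequality the functions
   equal to [a], resp. [b], on the corresponding bands of [psi] are [<< u],
   resp. [<< v], and [psi] is at most [c] times their sum.  Let [c] tend to 1;
   with [{phi, psi} = {|f|, f^*}] this gives both inequalities. *)

(** In general no measure-preserving map carries [|f|] to [f^*] or back: [f^*] does not see the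
    values of [|f|] below its limit at infinity. So decompositions cannot be transported by
    composition, and only the measures of level bands are compared between the two spaces. Since
    [is_canonical_norm] provides a formula for the norm over the half-line and none of its norm
    axioms, the norm and its representation are first written as one functional of the
    rearrangement, and monotonicity is proved for that functional. The proof of monotonicity avoids
    duality: on finitely many disjoint sets of equal measure the norm of a step function is a
    monotone, convex, permutation-invariant function of the coefficients, and the Fatou property
    leads from there to the general case. The sets are the atoms in the atomic case and the
    preimages of dyadic intervals under [sigma] in the non-atomic case. *)

Set Implicit Arguments.
Unset Strict Implicit.
Unset Printing Implicit Defensive.

Import Order.TTheory GRing.Theory Num.Theory.
Import numFieldNormedType.Exports.

Local Open Scope classical_set_scope.
Local Open Scope ring_scope.

(** * Moduli and rearrangements *)

Section modulus.
Context d (T : measurableType d) (R : realType).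
Local Open Scope ereal_scope.

Lemma xmod_ge0 (z : xcomplex R) : 0 <= xmod z.
Proof. by case: z => [[a b]|] //=; rewrite lee_fin sqrtr_ge0. Qed.

Lemma xmod_of_ereal (r : \bar R) : 0 <= r -> xmod (xcomplex_of_ereal r) = r.
Proof.
by case: r => [r| |]//; rewrite lee_fin /= expr0n addr0 sqrtr_sqr => /ger0_norm ->.
Qed.

Lemma xmod_add (z w : xcomplex R) : xmod (xadd z w) <= xmod z + xmod w.
Proof.
case: z => [z|]; case: w => [w|] //=; try by rewrite leey.
by rewrite lee_fin; exact: le_normcD.
Qed.

Lemma measurable_xmod (f : T -> xcomplex R) :
  xmeasurable f -> measurable_fun setT (fun x => xmod (f x)).
Proof.
move=> [mN mRe mIm].
have -> : (fun x => xmod (f x)) =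
  (fun x => if `[< f x = None >] then +oo else
    (Num.sqrt (complex.Re (xfin (f x)) ^+ 2 + complex.Im (xfin (f x)) ^+ 2))%:E).
  apply/funext => x; case: asboolP => [->//|].
  by case: (f x) => [[a b]|].
apply: measurable_fun_if => //.
- apply: (measurable_fun_bool true); rewrite setTI.
  by rewrite [X in measurable X](_ : _ = [set x | f x = None])//;
     apply/seteqP; split=> x /= /asboolP.
- apply: (@measurable_funS _ _ _ _ setT) => //.
  apply/measurable_EFinP; apply: measurableT_comp => //.
    by apply: continuous_measurable_fun; exact: sqrt_continuous.
  exact: (@measurable_funD _ _ _ setT _ _ (measurable_funX 2 mRe) (measurable_funX 2 mIm)).
Qed.

Lemma of_nneg_xmeasurable (u : T -> \bar R) :
  nneg_measurable u -> xmeasurable (of_nneg u).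
Proof.
move=> [mu u0]; split.
- rewrite [X in measurable X](_ : _ = u @^-1` [set +oo]).
    by rewrite -[X in measurable X]setTI; exact: mu.
  by apply/seteqP; split=> x; rewrite /of_nneg /=; have := u0 x; case: (u x).
- rewrite (_ : (fun x => _) = fine \o u).
    exact: measurableT_comp.
  by apply/funext=> x; rewrite /of_nneg /=; case: (u x).
- rewrite (_ : (fun x => _) = cst 0%R)//.
  by apply/funext=> x; rewrite /of_nneg /=; case: (u x).
Qed.

Lemma xmod_nneg_measurable (f : T -> xcomplex R) :
  xmeasurable f -> nneg_measurable (fun x => xmod (f x)).
Proof. by move=> mf; split; [exact: measurable_xmod|move=> x; exact: xmod_ge0]. Qed.

Lemma xmod_of_nneg (u : T -> \bar R) x : nneg_measurable u -> xmod (of_nneg u x) = u x.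
Proof. by move=> [_ u0]; rewrite xmod_of_ereal. Qed.

End modulus.

Section rearrangement.
Context d (T : measurableType d) (R : realType) (mu : {measure set T -> \bar R}).
Local Open Scope ereal_scope.

Lemma measurable_gt (u : T -> \bar R) (r : \bar R) : measurable_fun setT u ->
  measurable [set x | r < u x].
Proof.
by move=> mu_; rewrite -[X in measurable X]setTI; exact: emeasurable_fun_o_infty.
Qed.

(** Continuity from below along [{u > s + 1/(n+1)}], which increases to [{u > s}]. The form with
    strict inequalities also covers infinite measure. *)
Lemma distribution_right_continuous (u : T -> \bar R) (s : R) (a : \bar R) :
  measurable_fun setT u -> a < mu [set x | s%:E < u x] ->
  exists2 s' : R, (s < s')%R & a < mu [set x | s'%:E < u x].
Proof.
move=> mu_ lt_a.
pose F n := [set x | (s + n.+1%:R^-1)%:E < u x].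
have FE : \bigcup_n F n = [set x | s%:E < u x].
  apply/seteqP; split=> x /= => [[n _]|].
    by apply: lt_trans; rewrite lte_fin ltrDl invr_gt0.
  move=> sux; case ux : (u x) sux => [v| |]//.
    rewrite lte_fin -subr_gt0 => /ltr_add_invr[n]; rewrite add0r => Hn.
    by exists n => //; rewrite /F /= ux lte_fin -ltrBrDl.
  by exists 0%N => //; rewrite /F /= ux ltry.
have mF n : measurable (F n) by exact: measurable_gt.
have := @nondecreasing_cvg_mu _ _ _ mu F mF.
rewrite FE => /(_ (measurable_gt _ mu_)).
have ndF : nondecreasing_seq F.
  move=> m n mn; apply/subsetPset => x; apply: le_lt_trans.
  by rewrite lee_fin lerD2l lef_pV2 ?posrE// ler_nat.
move=> /(_ ndF) cvgF.
apply: contrapT => /forall2NP H.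
have : mu [set x | s%:E < u x] <= a.
  rewrite -(cvg_lim _ cvgF)//; apply: lime_le; first by apply/cvg_ex; eexists; exact: cvgF.
  near=> n; rewrite leNgt; apply/negP => an.
  case: (H (s + n.+1%:R^-1)%R) => //; apply.
  by rewrite ltrDl invr_gt0.
by rewrite leNgt lt_a.
Unshelve. all: by end_near. Qed.

Variable f : T -> xcomplex R.
Hypothesis mf : xmeasurable f.

Lemma rearr_ge0 (t : R) : 0 <= rearr mu f t.
Proof. by apply: le_ereal_inf_tmp => _ [s [s0 _] <-]; rewrite lee_fin. Qed.

(** The Galois connection between rearrangement and distribution function; the right-to-left
    direction is right-continuity of the latter. Measurability, distribution and right-continuity of
    [rearr] are all read off from it. *)
Lemma rearr_gt (s t : R) : (0 <= s)%R ->
  (s%:E < rearr mu f t) = (t%:E < mu [set x | s%:E < xmod (f x)]).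
Proof.
move=> s0; apply/idP/idP => [lt_s|lt_t].
  rewrite ltNge; apply: contraTN lt_s => le_t; rewrite -leNgt.
  by apply: ge_ereal_inf; exists s%:E => //; exists s.
have [s' ss' lt_t'] := distribution_right_continuous (measurable_xmod mf) lt_t.
apply: (@lt_le_trans _ _ s'%:E); first by rewrite lte_fin.
apply: le_ereal_inf_tmp => _ [r [r0 le_r] <-]; rewrite lee_fin leNgt.
apply/negP => rs'; move: lt_t'; rewrite ltNge => /negP; apply.
apply: le_trans le_r; apply: le_measure; rewrite ?inE;
  try by apply: measurable_gt; exact: measurable_xmod.
by move=> x /=; apply: le_lt_trans; rewrite lee_fin ltW.
Qed.

Lemma rearr_nonincreasing : {homo rearr mu f : s t / (s <= t)%R >-> t <= s}.
Proof.
move=> s t st; apply: ereal_inf_le_tmp => _ [r [r0 rs] <-].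
by exists r => //; split=> //; apply: le_trans rs _; rewrite lee_fin.
Qed.

Lemma measurable_rearr : measurable_fun setT (rearr mu f : measurableTypeR R -> \bar R).
Proof.
apply: (measurability _ (ErealGenOInfty.measurableE R)) => _ [_ [r ->] <-].
rewrite setTI; have [r0|r0] := leP 0%R r; last first.
  rewrite (_ : _ @^-1` _ = setT)//; apply/seteqP; split=> // t _ /=.
  by rewrite in_itv/= andbT; apply: lt_le_trans (rearr_ge0 t); rewrite lte_fin.
rewrite (_ : _ @^-1` _ = EFin @^-1` `]-oo, mu [set x | r%:E < xmod (f x)][%classic).
  by rewrite -[X in measurable X]setTI; apply: EFin_measurable => //; exact:
    emeasurable_itv.
apply/seteqP; split=> t /=; rewrite !in_itv/= andbT rearr_gt//.
Qed.

Lemma rearr_nneg_measurable : nneg_measurable (rearr mu f : measurableTypeR R -> \bar R).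
Proof. by split; [exact: measurable_rearr|exact: rearr_ge0]. Qed.

End rearrangement.

Section halfline.
Context (R : realType).
Local Open Scope ereal_scope.

Lemma halfline_lt (a : \bar R) : 0 <= a -> halfline_measure R [set t | t%:E < a] = a.
Proof.
move=> a0; rewrite /halfline_measure /= /mrestr.
case: a a0 => [a| |]// a0.
- rewrite (_ : _ `&` _ = `[0%R, a[%classic); last first.
    apply/seteqP; split=> t /=; rewrite !in_itv/= ?andbT lte_fin.
      by case=> -> ->.
    by case/andP=> -> ->.
  by rewrite lebesgue_measure_itv/= lte_fin; case: ltP; rewrite ?oppr0 ?adde0//;
    rewrite le_eqVlt ltNge -lee_fin a0 orbF => /eqP ->.
- rewrite (_ : _ `&` _ = `[0%R, +oo[%classic); last first.
    by apply/seteqP; split=> t /=; rewrite !in_itv/= ?andbT ltry => // -[].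
  by rewrite lebesgue_measure_itv /= ltry.
Qed.

Lemma rearr_equimeasurable d (T : measurableType d) (mu : {measure set T -> \bar R})
    (f : T -> xcomplex R) (s : R) : xmeasurable f -> (0 <= s)%R ->
  halfline_measure R [set t | s%:E < rearr mu f t] = mu [set x | s%:E < xmod (f x)].
Proof.
move=> mf s0; rewrite -[RHS]halfline_lt//; congr (halfline_measure R _).
by apply/seteqP; split => t /=; rewrite rearr_gt.
Qed.

Lemma eq_rearr d1 d2 (T1 : measurableType d1) (T2 : measurableType d2)
    (mu1 : {measure set T1 -> \bar R}) (mu2 : {measure set T2 -> \bar R})
    (f1 : T1 -> xcomplex R) (f2 : T2 -> xcomplex R) :
  (forall s : R, (0 <= s)%R ->
    mu1 [set x | s%:E < xmod (f1 x)] = mu2 [set x | s%:E < xmod (f2 x)]) ->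
  rearr mu1 f1 = rearr mu2 f2.
Proof.
move=> eq12; apply/funext => t; congr (ereal_inf (_ @` _)).
by apply/seteqP; split=> s /= [s0]; rewrite eq12.
Qed.

End halfline.

Section layer_cake.
Context d (T : measurableType d) (R : realType).
Local Open Scope ereal_scope.

(** Tonelli for the indicator of the region under the graph of [u]. The integrand is cut off at
    negative [r] because the outer integral runs over the whole line. *)
Lemma layer_cake (mu : {measure set T -> \bar R}) (u : T -> \bar R) :
  sigma_finite setT mu -> nneg_measurable u ->
  \int[mu]_x u x =
  \int[@lebesgue_measure R]_r (if (0 <= r)%R then mu [set x | r%:E < u x] else 0).
Proof.
move=> sf [mu_ u0].
(* [mu] is repackaged together with its sigma-finiteness as the structure that Tonelli's theorem
   expects. *)
pose H0 := isSFinite.Build _ _ _ _ (sfinite_measure_sigma_finite sf).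
pose H := isSigmaFinite.Build _ _ _ _ sf.
pose nu := HB.pack_for (SigmaFiniteMeasure.type T R) (Measure.sort mu) H0 H.
have munu : mu = nu by exact: eq_measure.
clearbody nu.
pose A : set (T * measurableTypeR R) := [set p | (0 <= p.2)%R /\ p.2%:E < u p.1].
have mA : measurable A.
  have -> : A = (setT `&` snd @^-1` `[0%R, +oo[) `&`
      (setT `&` [set p | (EFin \o snd) p < (u \o fst) p]).
    rewrite !setTI; apply/seteqP; split=> p; rewrite /A /= in_itv/= andbT;
      by case.
  apply: measurableI.
    by apply: (@measurable_snd _ _ T (measurableTypeR R)) => //; exact: measurable_itv.
  apply: measurable_lte => //.
    by apply/measurable_EFinP; exact: measurable_snd.
  by apply: measurableT_comp => //; exact: measurable_fst.
have mf : measurable_fun setT (fun p => (\1_A p)%:E : \bar R).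
  by apply/measurable_EFinP; exact: measurable_indic.
have FT : \int[mu]_x \int[@lebesgue_measure R]_y (\1_A (x, y))%:E =
    \int[@lebesgue_measure R]_y \int[mu]_x (\1_A (x, y))%:E :> \bar R.
  rewrite munu.
  by apply: (@fubini_tonelli _ _ _ _ _ nu (@lebesgue_measure R) _ mf) => p; rewrite lee_fin.
transitivity (\int[mu]_x \int[@lebesgue_measure R]_y (\1_A (x, y))%:E : \bar R).
- apply: eq_integral => x _.
  transitivity (lebesgue_measure ([set t : R | t%:E < u x] `&` `[0%R, +oo[)).
    exact: esym (halfline_lt (u0 x)).
  have <- : xsection A x = [set t : R | t%:E < u x] `&` `[0%R, +oo[.
    by apply/seteqP; split=> t; rewrite /xsection /A /= inE /= in_itv/= andbT => -[].
  rewrite -[X in lebesgue_measure X]setIT -integral_indic//; last exact: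
    measurable_xsection.
  by apply: eq_integral => t _; rewrite !indicE /xsection /= mem_setE.
- rewrite FT; apply: eq_integral => t _; case: ifPn => t0; last first.
    apply: integral0_eq => x _; rewrite indicE memNset// => -[/=].
    by rewrite (negPf t0).
  have -> : [set x | t%:E < u x] = ysection A t.
    by apply/seteqP; split=> x; rewrite /ysection /A /= inE /= => // -[].
  rewrite -[X in _ = mu X]setIT -integral_indic//; last exact: measurable_ysection.
  by apply: eq_integral => x _; rewrite !indicE /ysection /= mem_setE.
Qed.

End layer_cake.

Section equimeasurable_integral.
Context (R : realType).
Local Open Scope ereal_scope.

Lemma halfline_sigma_finite : sigma_finite setT (halfline_measure R).
Proof.
exists (fun n : nat => [set t : R | t%:E < n%:R%:E]).
  apply/seteqP; split=> // t _.
  exists (Num.truncn `|t|).+1 => //=.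
  by rewrite lte_fin (le_lt_trans (ler_norm t))// truncnS_gt.
move=> n; split.
  rewrite -[X in measurable X]setTI.
  by apply: measurable_lte => //; exact: EFin_measurable.
by rewrite halfline_lt ?ltry// lee_fin.
Qed.

Lemma eq_integral_equimeasurable d1 d2 (T1 : measurableType d1) (T2 : measurableType d2)
    (mu1 : {measure set T1 -> \bar R}) (mu2 : {measure set T2 -> \bar R})
    (u1 : T1 -> \bar R) (u2 : T2 -> \bar R) :
  sigma_finite setT mu1 -> sigma_finite setT mu2 ->
  nneg_measurable u1 -> nneg_measurable u2 ->
  (forall s : R, (0 <= s)%R -> mu1 [set x | s%:E < u1 x] = mu2 [set x | s%:E < u2 x]) ->
  \int[mu1]_x u1 x = \int[mu2]_x u2 x.
Proof.
move=> sf1 sf2 m1 m2 eq12; rewrite (layer_cake sf1 m1) (layer_cake sf2 m2).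
by apply: eq_integral => s _; case: ifPn => // s0; rewrite eq12.
Qed.

End equimeasurable_integral.

(** * Submajorization *)

Section excess.
Context (R : realType).
Local Open Scope ereal_scope.

Definition excess (s : R) (r : \bar R) : \bar R := maxe (r - s%:E) 0.

Lemma excess_ge0 s r : 0 <= excess s r.
Proof. by rewrite le_max lexx orbT. Qed.

Lemma le_excess s : {homo excess s : r1 r2 / r1 <= r2}.
Proof.
by move=> r1 r2 r12; rewrite ge_max !le_max lexx orbT andbT leeD2r.
Qed.

Lemma excess_le s r : (0 <= s)%R -> 0 <= r -> excess s r <= r.
Proof.
by move=> s0 r0; rewrite ge_max r0 andbT leeBlDr// leeDl// lee_fin.
Qed.

Lemma le_add_excess s r : r <= s%:E + excess s r.
Proof. by rewrite addeC -leeBlDr// le_max lexx. Qed.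

Lemma add_excess s r : s%:E <= r -> s%:E + excess s r = r.
Proof.
move=> sr; rewrite /excess; have /max_idPl -> : 0 <= r - s%:E by rewrite sube_ge0.
by rewrite addeC subeK.
Qed.

Lemma excess0 s : (0 <= s)%R -> excess s 0 = 0.
Proof. by move=> s0; apply/eqP; rewrite eq_le excess_ge0 andbT excess_le. Qed.

Lemma excess_gt s r a : (0 <= a)%R -> (a%:E < excess s r) = ((s + a)%:E < r).
Proof.
by move=> a0; rewrite lt_max lte_fin [(_ < 0)%R]ltNge a0 orbF lteBrDr// -EFinD addrC.
Qed.

Lemma measurable_excess d (T : measurableType d) (D : set T) (u : T -> \bar R) s :
  measurable_fun D u -> measurable_fun D (fun x => excess s (u x)).
Proof.
by move=> mu; apply: measurable_maxe => //; exact: emeasurable_funB.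
Qed.

Definition submajorized d1 d2 (T1 : measurableType d1) (T2 : measurableType d2)
    (mu1 : {measure set T1 -> \bar R}) (mu2 : {measure set T2 -> \bar R})
    (u1 : T1 -> \bar R) (u2 : T2 -> \bar R) : Prop :=
  forall s : R, (0 <= s)%R ->
    \int[mu1]_x excess s (u1 x) <= \int[mu2]_x excess s (u2 x).

Lemma submajorized_equimeasurable d1 d2 (T1 : measurableType d1) (T2 : measurableType d2)
    (mu1 : {measure set T1 -> \bar R}) (mu2 : {measure set T2 -> \bar R})
    (u1 : T1 -> \bar R) (u2 : T2 -> \bar R) (s : R) :
  sigma_finite setT mu1 -> sigma_finite setT mu2 ->
  nneg_measurable u1 -> nneg_measurable u2 ->
  (forall s : R, (0 <= s)%R -> mu1 [set x | s%:E < u1 x] = mu2 [set x | s%:E < u2 x]) ->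
  (0 <= s)%R -> \int[mu1]_x excess s (u1 x) = \int[mu2]_x excess s (u2 x).
Proof.
move=> sf1 sf2 [m1 u10] [m2 u20] eq12 s0; apply: eq_integral_equimeasurable => //.
- by split; [exact: measurable_excess|move=> x; exact: excess_ge0].
- by split; [exact: measurable_excess|move=> x; exact: excess_ge0].
- move=> a a0; rewrite (_ : [set x | _ < excess s (u1 x)] = [set x | (s + a)%:E < u1 x]).
    rewrite eq12 ?addr_ge0//; congr (mu2 _).
    by apply/seteqP; split=> x /=; rewrite excess_gt.
  by apply/seteqP; split=> x /=; rewrite excess_gt.
Qed.

Lemma halfline_itv (a b : R) : (0 <= a <= b)%R ->
  halfline_measure R `[a, b[%classic = (b - a)%:E.
Proof.
move=> /andP[a0 ab]; rewrite /halfline_measure /= /mrestr.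
rewrite (_ : _ `&` _ = `[a, b[%classic); last first.
  apply/seteqP; split=> x /=; rewrite !in_itv /= ?andbT; first by case.
  by move=> /andP[ax xb]; rewrite ax xb (le_trans a0 ax).
rewrite lebesgue_measure_itv/= lte_fin; case: ltP => // ba.
by rewrite (@le_anti _ _ a b) ?subrr// ab.
Qed.

(** One value of [s] suffices, namely [v2 t]: always [v1 <= s + excess s v1], while
    [v2 = s + excess s v2] on [[0, t[] and [excess s v2] vanishes from [t] on. *)
Lemma submajorized_integral (v1 v2 : measurableTypeR R -> \bar R) (t : R) :
  nneg_measurable v1 -> nneg_measurable v2 ->
  (forall x y : R, (0 <= x)%R -> (x <= y)%R -> v2 y <= v2 x) ->
  submajorized (halfline_measure R) (halfline_measure R) v1 v2 ->
  (0 <= t)%R ->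
  \int[halfline_measure R]_(x in `[0%R, t[) v1 x <=
  \int[halfline_measure R]_(x in `[0%R, t[) v2 x.
Proof.
move=> [m1 v10] [m2 v20] ni sub; rewrite le_eqVlt => /predU1P[<-|t0].
  by rewrite set_itvco0 !integral_set0.
have mI : measurable (`[0%R, t[%classic : set (measurableTypeR R)) by exact: measurable_itv.
have muI : halfline_measure R `[0%R, t[%classic = t%:E.
  by rewrite halfline_itv ?subr0// lexx ltW.
have m1I : measurable_fun (`[0%R, t[%classic : set (measurableTypeR R)) v1 by exact:
  measurable_funS m1.
have m2I : measurable_fun (`[0%R, t[%classic : set (measurableTypeR R)) v2 by exact:
  measurable_funS m2.
case vt : (v2 t) => [s| |]; last by have := v20 t; rewrite vt.
- have s0 : (0 <= s)%R by have := v20 t; rewrite vt lee_fin.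
  have leI v : nneg_measurable v ->
      \int[halfline_measure R]_(x in `[0%R, t[) (s%:E + excess s (v x)) =
      s%:E * t%:E + \int[halfline_measure R]_(x in `[0%R, t[) excess s (v x).
    move=> [mv v0]; rewrite ge0_integralD//=.
    + by rewrite integral_cst// [X in _ * X]muI.
    + by move=> x _; exact: excess_ge0.
    + by apply: measurable_excess; exact: measurable_funS mv.
  apply: (@le_trans _ _ (\int[halfline_measure R]_(x in `[0%R, t[) (s%:E + excess s (v1
    x)))).
    apply: ge0_le_integral => //.
    + by apply: emeasurable_funD => //; exact: measurable_excess.
    + by move=> x _; exact: le_add_excess.
  rewrite leI//; apply: (@le_trans _ _ (s%:E * t%:E + \int[halfline_measure R]_x excess s
    (v2 x))).
    rewrite leeD2l//; apply: le_trans (sub s s0).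
    apply: ge0_subset_integral => //; first exact: measurable_excess.
    by move=> x _; exact: excess_ge0.
  rewrite [X in _ + X](_ : _ = \int[halfline_measure R]_(x in `[0%R, t[) excess s (v2 x)).
    rewrite -leI//; apply: ge0_le_integral => //.
    + by move=> x _; rewrite adde_ge0// excess_ge0.
    + by apply: emeasurable_funD => //; exact: measurable_excess.
    + move=> x /=; rewrite in_itv/= => /andP[x0 xt].
      by rewrite add_excess// -vt; apply: ni => //; exact: ltW.
  rewrite [RHS]integral_mkcond; apply: ae_eq_integral => //.
  + exact: measurable_excess.
  + by apply/measurable_restrict => //; rewrite setTI; exact: measurable_excess.
  (* [v2] is monotone on [[0, +oo[] only; the negative half-line is a null set. *)
  exists [set x : R | (x < 0)%R]; split.
  + by rewrite [X in measurable X](_ : _ = `]-oo, 0%R[%classic)//;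
      apply/seteqP; split=> x /=; rewrite in_itv.
  + rewrite /halfline_measure/= /mrestr (_ : _ `&` _ = set0) ?measure0//.
    by apply/seteqP; split=> x //= []; rewrite in_itv/= andbT leNgt => ->.
  + move=> x /= H; rewrite ltNge; apply/negP => x0; apply: H => _.
    rewrite patchE; case: ifPn => //; rewrite notin_setE/= in_itv/= x0/= => /negP.
    rewrite -leNgt => tx; apply/eqP; rewrite eq_le excess_ge0 andbT.
    by rewrite ge_max lexx andbT sube_le0 -vt; apply: ni => //; exact: ltW.
(* Here [v2 t = +oo], so [v2] is infinite on all of [[0, t[], a set of positive measure. *)
- rewrite [leRHS](_ : _ = +oo) ?leey//; apply/eqP; rewrite -leye_eq.
  apply: (@le_trans _ _ (\int[halfline_measure R]_(x in `[0%R, t[) (cst +oo x))).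
    by rewrite integral_cst// [X in _ * X]muI gt0_mulye// lte_fin.
  apply: ge0_le_integral => // x /=; rewrite in_itv/= => /andP[x0 xt].
    by rewrite leey.
  by rewrite -vt; apply: ni => //; exact: ltW.
Qed.

End excess.

(** * The Hardy-Littlewood-Polya principle for step functions *)

Section hardy_littlewood_polya.
Context d (T : measurableType d) (R : realType) (mu : {measure set T -> \bar R}).
Variable N : (T -> xcomplex R) -> \bar R.
Hypothesis N_ri : is_ri_norm mu N.
Local Open Scope ereal_scope.

Lemma ri_nneg_ge0 (u : T -> \bar R) : nneg_measurable u -> 0 <= N (of_nneg u).
Proof. by move=> mu_; apply: (ri_ge0 N_ri); exact: of_nneg_xmeasurable. Qed.

Lemma ri_scale_nneg (a : R) (u : T -> \bar R) : (0 <= a)%R -> nneg_measurable u ->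
  N (of_nneg (fun x => a%:E * u x)) = a%:E * N (of_nneg u).
Proof.
move=> a0 mu_; have := ri_scale N_ri (Complex a 0%R) mu_.
rewrite /= expr0n addr0 sqrtr_sqr ger0_norm// => <-; congr N.
apply/funext => x; rewrite /of_nneg; have := mu_.2 x; case: (u x) => [r| |]// _.
  rewrite -EFinM; apply: (f_equal Some); apply/eqP.
  by rewrite eq_complex /= !mulr0 mul0r subr0 addr0 !eqxx.
rewrite /=; move: a0; rewrite le_eqVlt => /predU1P[<-|a0].
  by rewrite mul0e /= eqxx.
rewrite gt0_muley// /= ifF//; apply/eqP => -[a00].
by rewrite a00 ltxx in a0.
Qed.

Lemma ri_le (u v : T -> \bar R) : nneg_measurable u -> nneg_measurable v ->
  (forall x, u x <= v x) -> N (of_nneg u) <= N (of_nneg v).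
Proof. by move=> mu_ mv uv; apply: (ri_lattice N_ri) => //; exact: aeW. Qed.

Lemma ri_equimeasurable (u v : T -> \bar R) : nneg_measurable u -> nneg_measurable v ->
  (forall s : R, (0 <= s)%R -> mu [set x | s%:E < u x] = mu [set x | s%:E < v x]) ->
  N (of_nneg u) = N (of_nneg v).
Proof.
move=> mu_ mv eq_uv; apply: (ri_rearr N_ri); try exact: of_nneg_xmeasurable.
move=> t _; congr (_ t); apply: eq_rearr => s s0.
under eq_set do rewrite (xmod_of_nneg _ mu_).
by under [in RHS]eq_set do rewrite (xmod_of_nneg _ mv); exact: eq_uv.
Qed.

Variables (L : nat) (e : 'I_L -> set T) (beta : R).
Hypothesis me : forall i, measurable (e i).
Hypothesis mue : forall i, mu (e i) = beta%:E.
Hypothesis trive : trivIset setT e.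

Definition step (x : 'I_L -> R) (t : T) : \bar R :=
  \sum_(i < L) (x i)%:E * (\1_(e i) t)%:E.

Lemma step_in x i t : e i t -> step x t = (x i)%:E.
Proof.
move=> eit; rewrite /step (bigD1 i)//= indicE mem_set// mule1 big1 ?adde0// => j ji.
rewrite indicE memNset ?mule0// => ejt.
have : e i `&` e j !=set0 by exists t.
by move/trive => /(_ Logic.I Logic.I) ij; rewrite ij eqxx in ji.
Qed.

Lemma step_out x t : ~ (exists i, e i t) -> step x t = 0.
Proof.
by move=> H; rewrite /step big1// => i _; rewrite indicE memNset ?mule0// => eit; apply:
  H; exists i.
Qed.

Lemma step_nneg_measurable x : (forall i, (0 <= x i)%R) -> nneg_measurable (step x).
Proof.
move=> x0; split.
  apply: emeasurable_sum => i; apply: emeasurable_funM => //.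
  by apply/measurable_EFinP; exact: measurable_indic.
by move=> t; apply: sume_ge0 => i _; rewrite mule_ge0// lee_fin.
Qed.

Lemma step_distribution x (s : R) : (0 <= s)%R ->
  mu [set t | s%:E < step x t] = \sum_(i < L | (s < x i)%R) beta%:E.
Proof.
move=> s0; transitivity (mu (\big[setU/set0]_(i < L | (s < x i)%R) e i)).
  congr (mu _); rewrite -bigcup_seq_cond.
  apply/seteqP; split=> t /=.
    move=> st; have [[i eit]|H] := pselect (exists i, e i t).
      by exists i => //=; rewrite mem_index_enum/= -lte_fin -(step_in x eit).
    by move: st; rewrite (step_out x H) lte_fin ltNge s0.
  by move=> [i /= /andP[_ sx] eit]; rewrite (step_in x eit) lte_fin.
rewrite (@measure_bigsetU_ord_cond _ _ _ mu)//.
  by apply: eq_bigr => i _; exact: mue.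
exact: sub_trivIset trive.
Qed.

Lemma step_perm (x : 'I_L -> R) (p : {perm 'I_L}) : (forall i, (0 <= x i)%R) ->
  N (of_nneg (step (x \o p))) = N (of_nneg (step x)).
Proof.
move=> x0; apply: ri_equimeasurable.
- by apply: step_nneg_measurable => i; exact: x0.
- exact: step_nneg_measurable.
move=> s s0; rewrite !step_distribution//=.
by rewrite [RHS](reindex_inj (@perm_inj _ p)).
Qed.

Lemma step_convex (x y : 'I_L -> R) (a b : R) : (forall i, (0 <= x i)%R) -> (forall i, (0
  <= y i)%R) ->
  (0 <= a)%R -> (0 <= b)%R ->
  N (of_nneg (step (fun i => a * x i + b * y i)%R)) <=
  a%:E * N (of_nneg (step x)) + b%:E * N (of_nneg (step y)).
Proof.
move=> x0 y0 a0 b0.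
have mx := step_nneg_measurable x0; have my := step_nneg_measurable y0.
have mZ c (u : T -> \bar R) : (0 <= c)%R -> nneg_measurable u -> nneg_measurable (fun t
  => c%:E * u t : \bar R).
  move=> c0 [m u0]; split; first exact: measurable_funeM.
  by move=> t; rewrite mule_ge0// lee_fin.
rewrite -(ri_scale_nneg a0 mx) -(ri_scale_nneg b0 my).
apply: (le_trans _ (ri_triangle N_ri (mZ _ _ a0 mx) (mZ _ _ b0 my))).
apply: ri_le.
- by apply: step_nneg_measurable => i; rewrite addr_ge0// mulr_ge0.
- split; first by apply: emeasurable_funD; [exact: (mZ _ _ a0 mx).1|exact: (mZ _ _ b0
  my).1].
  by move=> t; rewrite adde_ge0//; [exact: (mZ _ _ a0 mx).2|exact: (mZ _ _ b0 my).2].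
move=> t; have [[i eit]|H] := pselect (exists i, e i t).
  by rewrite /= !(step_in _ eit) -!EFinM -EFinD.
by rewrite /= !(step_out _ H) !mule0 adde0.
Qed.

(* Induction on the number of indices where [x] and [y] differ: a T-transform
   of [y], which is a convex combination of [y] and a transposition of [y],
   makes one more coordinate agree with [x]. *)
Lemma step_majorized (x y : 'I_L -> R) :
  (forall i, (0 <= x i)%R) -> (forall i, (0 <= y i)%R) ->
  (forall i j : 'I_L, (i <= j)%N -> (x j <= x i)%R) ->
  (forall k : nat, (\sum_(i < L | (i < k)%N) x i <= \sum_(i < L | (i < k)%N) y i)%R) ->
  N (of_nneg (step x)) <= N (of_nneg (step y)).
Proof.
move=> x0 + nix; move: {2}#|[pred i | x i != y i]| (leqnn #|[pred i | x i != y i]|) => m.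
elim: m y => [|m IH] y card_xy y0 sxy.
  suff -> : x = y by [].
  apply/funext => i; apply/eqP; apply/negPn/negP => xyi.
  by move: card_xy; rewrite leqn0 => /eqP/card0_eq/(_ i); rewrite inE xyi.
have [/forallP le_xy|] := boolP [forall i, (x i <= y i)%R].
  apply: ri_le; try exact: step_nneg_measurable.
  move=> t; have [[i eit]|H] := pselect (exists i, e i t).
    by rewrite !(step_in _ eit) lee_fin.
  by rewrite !(step_out _ H).
rewrite negb_forall => /existsP[k0]; rewrite -ltNge => k0P.
(* [k] is the first index where [y] falls below [x]. The partial sums up to and including [k] then
   force an earlier index [j] where [y] exceeds [x]. *)
case: (@arg_minnP _ k0 (fun i : 'I_L => (y i < x i)%R) (fun i => i : nat) k0P) => k yxk
  kmin.
have le_below (i : 'I_L) : (i < k)%N -> (x i <= y i)%R.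
  by move=> ik; rewrite leNgt; apply/negP => /kmin; rewrite leqNgt ik.
have [j jk xyj] : exists2 j : 'I_L, (j < k)%N & (x j < y j)%R.
  apply: contrapT => /forall2NP H.
  have := sxy k.+1; rewrite (bigD1 k)//= [leRHS](bigD1 k)//= leNgt => /negP; apply.
  apply: ltr_leD => //; apply: ler_sum => i /andP[]; rewrite ltnS leq_eqVlt =>
    /orP[/eqP/val_inj->|ik].
    by rewrite eqxx.
  by move=> _; case: (H i) => // /negP; rewrite -leNgt.
have jNk : j != k by apply: contraTneq jk => ->; rewrite ltnn.
have kNj : (k == j) = false by rewrite eq_sym; exact: negPf.
have xkj : (x k <= x j)%R by apply: nix; exact: ltnW.
(* The largest transfer from [j] to [k] that overshoots neither [x j] nor [x k]; after it, [y']
   agrees with [x] at one of the two. *)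
pose del : R := (Num.min (y j - x j) (x k - y k))%R.
have del0 : (0 < del)%R by rewrite lt_min !subr_gt0 xyj yxk.
have delj : (del <= y j - x j)%R by rewrite ge_min lexx.
have delk : (del <= x k - y k)%R by rewrite ge_min lexx orbT.
pose y' i := (if i == j then y j - del else if i == k then y k + del else y i)%R.
have y'0 i : (0 <= y' i)%R.
  rewrite /y'; case: ifP => _; first by have := x0 j; lra.
  by case: ifP => _ //; have := y0 k; lra.
apply: (@le_trans _ _ (N (of_nneg (step y')))).
  apply: IH => //.
    rewrite -ltnS; apply: leq_trans card_xy; apply: proper_card; apply/properP; split.
      apply/fintype.subsetP => i; rewrite !inE /y'; case: ifPn => [/eqP->|_]; first by
        rewrite (lt_eqF xyj).
      by case: ifPn => [/eqP->|//]; rewrite (gt_eqF yxk).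
    have [djk|djk] := leP (y j - x j)%R (x k - y k)%R.
      exists j; rewrite !inE ?(lt_eqF xyj)// /y' eqxx.
      by rewrite /del (min_idPl djk) opprB addrC subrK eqxx.
    exists k; rewrite !inE ?(gt_eqF yxk)// /y' kNj eqxx.
    by rewrite /del (min_idPr (ltW djk)) addrC subrK eqxx.
  (* Partial sums of [y']: unchanged for [K <= j] and for [K > k]. In between they lose [del], but
     there [x <= y'] holds term by term. *)
  move=> K; have [Kj|jK] := leqP K j.
    rewrite [leRHS](eq_bigr y) => [|i iK]; first exact: sxy.
    rewrite /y' !ifF//; apply/eqP => ik; move: iK; rewrite ik ltnNge.
      by rewrite (leq_trans Kj)// ltnW.
    by rewrite Kj.
  have [Kk|kK] := leqP K k.
    rewrite -subr_ge0 -sumrB (bigD1 j)//= {1}/y' eqxx; apply: addr_ge0; first by rewrite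
      addrAC subr_ge0.
    apply: sumr_ge0 => i /andP[iK ij]; rewrite /y' (negPf ij) ifF; last first.
      by apply/eqP => ik; move: iK; rewrite ik ltnNge Kk.
    by rewrite subr_ge0 le_below// (leq_trans iK).
  suff -> : (\sum_(i < L | (i < K)%N) y' i = \sum_(i < L | (i < K)%N) y i)%R by [].
  rewrite (bigD1 j)//= [RHS](bigD1 j)//= (bigD1 k) ?kK ?kNj//=.
  rewrite [in RHS](bigD1 k) ?kK ?kNj//= /y' eqxx kNj eqxx.
  rewrite (eq_bigr y) => [|i /andP[/andP[_ ij] ik]]; last by rewrite (negPf ij) (negPf ik).
  by lra.
(* Mixing [y] with its transposition in proportion [t] moves exactly [del]. The denominator is
   positive because [y j > x j >= x k > y k]. *)
pose t := (del / (y j - y k))%R.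
have yjk : (0 < y j - y k)%R by lra.
have t0 : (0 <= t)%R by rewrite divr_ge0// ltW.
have t1 : (0 <= 1 - t)%R by rewrite subr_ge0 ler_pdivrMr// mul1r; lra.
have -> : y' = (fun i => (1 - t) * y i + t * (y \o tperm j k) i)%R.
  apply/funext => i; rewrite /y' /=; have tE : (t * (y j - y k) = del)%R by rewrite
    divfK// gt_eqF.
  case: tpermP => [->|->|/eqP/negPf -> /eqP/negPf ->]; last by lra.
    by rewrite eqxx; lra.
  by rewrite kNj eqxx; lra.
apply: (le_trans (step_convex y0 _ t1 t0)) => [i|]; first exact: y0.
rewrite step_perm// -ge0_muleDl ?lee_fin//.
by rewrite -EFinD subrK mul1e.
Qed.

End hardy_littlewood_polya.

(** * Averages over the cells of a uniform grid of the half-line *)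

Section averages.
Context (R : realType).
Local Open Scope ereal_scope.
Variable beta : R.
Hypothesis beta0 : (0 < beta)%R.
Local Notation Hm := (halfline_measure R).

Definition cell (n : nat) : set (measurableTypeR R) :=
  `[(n%:R * beta)%R, (n.+1%:R * beta)%R[%classic.

Definition average (r : measurableTypeR R -> \bar R) (n : nat) : \bar R :=
  beta^-1%:E * \int[Hm]_(t in cell n) r t.

Lemma cell_le n : (n%:R * beta <= n.+1%:R * beta)%R.
Proof. by rewrite ler_pM2r// ler_nat. Qed.

Lemma measurable_cell n : measurable (cell n).
Proof. exact: measurable_itv. Qed.

Lemma halfline_cell n : Hm (cell n) = beta%:E.
Proof.
rewrite /cell halfline_itv; first by congr EFin; rewrite -mulrBl -natrB ?leqnSn// subSnn
  mul1r.
by rewrite cell_le mulr_ge0// ltW.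
Qed.

Lemma trivIset_cell : trivIset setT cell.
Proof.
move=> m n _ _ [t []]; rewrite /cell /= !in_itv/= => /andP[mt tm] /andP[nt tn].
have H i j : ((i%:R * beta <= t)%R -> (t < j.+1%:R * beta)%R -> (i <= j)%N).
  by move=> h1 h2; have := le_lt_trans h1 h2; rewrite ltr_pM2r// ltr_nat ltnS.
by apply/eqP; rewrite eqn_leq !H.
Qed.

Lemma average_ge0 r n : (forall t, 0 <= r t) -> 0 <= average r n.
Proof.
by move=> r0; apply: mule_ge0; [rewrite lee_fin invr_ge0 ltW|exact: integral_ge0].
Qed.

Lemma average_cst c n : average (cst c) n = c.
Proof.
rewrite /average integral_cst ?halfline_cell; last exact: measurable_cell.
by rewrite muleCA -EFinM mulVf ?mule1// gt_eqF.
Qed.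

Lemma le_average r1 r2 n :
  nneg_measurable r1 -> nneg_measurable r2 ->
  (forall t, cell n t -> r1 t <= r2 t) -> average r1 n <= average r2 n.
Proof.
move=> [m1 r10] [m2 r20] r12; rewrite lee_pmul2l ?lte_fin ?invr_gt0//.
have mc := measurable_cell n.
by apply: ge0_le_integral => //; exact: measurable_funS (measurableT) _ _.
Qed.

(** For [m < n] both averages are compared with the value of [r] at the left end of cell [n]. *)
Lemma average_nonincreasing r : nneg_measurable r ->
  (forall s t : R, (0 <= s)%R -> (s <= t)%R -> r t <= r s) ->
  forall m n, (m <= n)%N -> average r n <= average r m.
Proof.
move=> mr nir m n; rewrite leq_eqVlt => /predU1P[->//|mn].
apply: (@le_trans _ _ (r (n%:R * beta)%R)).
  rewrite -[leRHS](average_cst _ n); apply: le_average => //.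
    by split=> // t; exact: mr.2.
  move=> t; rewrite /cell/= in_itv/= => /andP[nt _]; apply: nir => //.
  by rewrite mulr_ge0// ltW.
rewrite -[leLHS](average_cst _ m); apply: le_average => //.
  by split=> // t; exact: mr.2.
move=> t; rewrite /cell/= in_itv/= => /andP[mt tm]; apply: nir.
  by apply: le_trans mt; rewrite mulr_ge0// ltW.
by apply/ltW/(lt_le_trans tm); rewrite ler_pM2r// ler_nat.
Qed.

Lemma sum_average r k : nneg_measurable r ->
  \sum_(n < k) average r n = beta^-1%:E * \int[Hm]_(t in `[0%R, (k%:R * beta)%R[) r t.
Proof.
move=> [mr r0]; elim: k => [|k IH].
  by rewrite big_ord0 mul0r set_itvco0 integral_set0 mule0.
have kb0 : (0 <= k%:R * beta)%R by rewrite mulr_ge0// ltW.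
rewrite big_ord_recr /= IH /average -ge0_muleDr ?integral_ge0//; congr (_ * _).
rewrite -ge0_integral_setU//=.
- congr (integral _ _ _); rewrite /cell; apply/seteqP; split=> t /=; rewrite !in_itv/=.
    case=> [/andP[-> /lt_le_trans->//]|/andP[/(le_trans kb0)-> ->//]].
    exact: cell_le.
  by move=> /andP[-> ->]; rewrite andbT /=; have [_|_] := leP (k%:R * beta)%R t;
    [right|left].
- exact: measurable_cell.
- exact: measurable_funS (measurableT) _ _.
- apply/disj_setPS => t [] /=; rewrite /cell/= !in_itv/= => /andP[_ tk] /andP[kt _].
  by move: kt; rewrite leNgt tk.
Qed.

End averages.

Section cellstep.
Context d (T : measurableType d) (R : realType).
Local Open Scope ereal_scope.
Variables (P : pred nat) (e : nat -> set T).
Hypothesis me : forall n, P n -> measurable (e n).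
Hypothesis trive : trivIset P e.
Implicit Types a b : nat -> \bar R.

Definition cellstep (a : nat -> \bar R) (x : T) : \bar R :=
  \sum_(0 <= n <oo | P n) a n * (\1_(e n) x)%:E.

Lemma cellstep_out a x : ~ (exists2 n, P n & e n x) -> cellstep a x = 0.
Proof.
move=> H; apply: eseries0 => n _ Pn; rewrite indicE memNset ?mule0// => enx.
by apply: H; exists n.
Qed.

Lemma cellstep_in a n x : (forall n, 0 <= a n) -> P n -> e n x ->
  cellstep a x = a n.
Proof.
move=> a0 Pn enx; rewrite /cellstep (@nneseriesD1 _ _ n)//; last first.
  by move=> k _; rewrite mule_ge0// lee_fin.
rewrite indicE mem_set// mule1 eseries0 ?adde0// => k _ /andP[Pk kn].
rewrite indicE memNset ?mule0// => ekx.
by move/eqP : kn; apply; apply: trive => //; exists x.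
Qed.

Lemma cellstep_nneg_measurable a : (forall n, 0 <= a n) -> nneg_measurable (cellstep a).
Proof.
move=> a0; split; last first.
  by move=> x; apply: nneseries_ge0 => n _ _; rewrite mule_ge0// lee_fin.
apply: ge0_emeasurable_sum => [n x _ _|n Pn]; first by rewrite mule_ge0// lee_fin.
apply: emeasurable_funM => //; apply/measurable_EFinP; apply: measurable_indic.
exact: me.
Qed.

Lemma le_cellstep a b : (forall n, 0 <= a n) -> (forall n, 0 <= b n) ->
  (forall n, P n -> a n <= b n) -> forall x, cellstep a x <= cellstep b x.
Proof.
move=> a0 b0 ab x; apply: lee_nneseries => [n _ _|n Pn].
  by rewrite mule_ge0// lee_fin.
by rewrite lee_wpmul2r ?ab// lee_fin.
Qed.

Lemma cellstep_comp a (h : \bar R -> \bar R) : (forall n, 0 <= a n) ->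
  (forall r, 0 <= r -> 0 <= h r) -> h 0 = 0 ->
  forall x, h (cellstep a x) = cellstep (h \o a) x.
Proof.
move=> a0 h0 h00 x; have [[n Pn enx]|H] := pselect (exists2 n, P n & e n x).
  by rewrite (cellstep_in a0 Pn enx) (cellstep_in _ Pn enx)// => k; exact: h0.
by rewrite !cellstep_out.
Qed.

Lemma integral_cellstep (mu : {measure set T -> \bar R}) a : (forall n, 0 <= a n) ->
  \int[mu]_x cellstep a x = \sum_(0 <= n <oo | P n) a n * mu (e n).
Proof.
move=> a0; rewrite /cellstep.
under eq_integral do rewrite eseries_mkcond.
rewrite integral_nneseries//.
- rewrite [RHS]eseries_mkcond; apply: eq_eseriesr => n _; case: ifPn => Pn; last exact:
  integral0.
  rewrite ge0_integralZl//; first by rewrite integral_indic ?setIT//; exact: me.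
  by apply/measurable_EFinP; apply: measurable_indic; exact: me.
- move=> n; case: (boolP (P n)) => Pn //; apply: emeasurable_funM => //.
  by apply/measurable_EFinP; apply: measurable_indic; exact: me.
- by move=> n x _; case: ifPn => Pn //; rewrite mule_ge0// lee_fin.
Qed.

End cellstep.

(** * Jensen's inequality and submajorization by step functions *)

Section jensen.
Context (R : realType).
Local Open Scope ereal_scope.

(** Integrate the pointwise bound [u <= s + excess s u] over [E]; the other term of the maximum is
    [0]. *)
Lemma jensen_excess d (T : measurableType d) (mu : {measure set T -> \bar R}) (E : set T)
    (b s : R) (u : T -> \bar R) : measurable E -> mu E = b%:E -> (0 < b)%R -> (0 <= s)%R ->
  nneg_measurable u ->
  b%:E * excess s (b^-1%:E * \int[mu]_(x in E) u x) <= \int[mu]_(x in E) excess s (u x).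
Proof.
move=> mE muE b0 s0 [mu_ u0].
have mEu : measurable_fun E u by exact: measurable_funS mu_.
have I0 : 0 <= \int[mu]_(x in E) excess s (u x).
  by apply: integral_ge0 => x _; exact: excess_ge0.
rewrite [excess s (_ * _)]/excess maxe_pMr//; last by rewrite lee_fin ltW.
rewrite mule0 ge_max I0 andbT.
rewrite muleBr ?fin_num_adde_defl// muleA -EFinM divff ?gt_eqF// mul1e leeBlDr//.
rewrite -EFinM (_ : (b * s)%:E = \int[mu]_(x in E) (cst s%:E x)); last first.
  by rewrite integral_cst// muE -EFinM mulrC.
rewrite -ge0_integralD//.
- apply: ge0_le_integral => //.
  + by apply: emeasurable_funD => //; exact: measurable_excess.
  + by move=> x _; rewrite addeC; exact: le_add_excess.
- by move=> x _; exact: excess_ge0.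
- exact: measurable_excess.
Qed.

(** [excess s] acts on a step function value by value, so the left integral is a series, and the
    disjoint sets [E n] bound it by the integral of [excess s (u x)]. Used on the half-line with
    [E = F], and between the two spaces with matching level sets. *)
Lemma cellstep_submajorized d1 d2 (T1 : measurableType d1) (T2 : measurableType d2)
    (mu1 : {measure set T1 -> \bar R}) (mu2 : {measure set T2 -> \bar R})
    (P : pred nat) (E : nat -> set T1) (F : nat -> set T2) (a : nat -> \bar R)
    (u : T1 -> \bar R) :
  (forall n, P n -> measurable (E n)) -> trivIset P E ->
  (forall n, P n -> measurable (F n)) -> trivIset P F ->
  (forall n, 0 <= a n) -> nneg_measurable u ->
  (forall n s, P n -> (0 <= s)%R ->
    mu2 (F n) * excess s (a n) <= \int[mu1]_(x in E n) excess s (u x)) ->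
  submajorized mu2 mu1 (cellstep P F a) u.
Proof.
move=> mE trivE mF trivF a0 [mu_ u0] H s s0.
have exa0 n : 0 <= (excess s \o a) n by exact: excess_ge0.
under eq_integral do rewrite (cellstep_comp trivF a0 (fun r _ => excess_ge0 s r) (excess0
  s0)).
rewrite integral_cellstep//.
pose E' n := if P n then E n else set0.
apply: (@le_trans _ _ (\sum_(0 <= n <oo) \int[mu1]_(x in E' n) excess s (u x))).
  rewrite eseries_mkcond; apply: lee_nneseries => n *.
    by case: ifP => // _; rewrite mule_ge0.
  rewrite /E'; case: ifPn => Pn; last by rewrite integral_set0.
  by rewrite muleC; exact: H.
have mex D : measurable_fun D (fun x => excess s (u x)).
  by apply: measurable_excess; exact: measurable_funS mu_.
have mE' n : measurable (E' n) by rewrite /E'; case: ifP => // /mE.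
rewrite -ge0_integral_bigcup//.
- by apply: ge0_subset_integral => //; [exact: bigcup_measurable|move=> x _; exact:
  excess_ge0].
- by move=> x _; exact: excess_ge0.
- move=> m n _ _ [x []]; rewrite /E'; case: ifPn => // Pm; case: ifPn => // Pn Emx Enx.
  by apply: trivE => //; exists x.
Qed.

End jensen.

(** * Majorized sequences placed on disjoint sets of equal measure *)

Section cells.
Context d (T : measurableType d) (R : realType) (mu : {measure set T -> \bar R}).
Variable N : (T -> xcomplex R) -> \bar R.
Hypothesis N_ri : is_ri_norm mu N.
Local Open Scope ereal_scope.
Variables (beta : R) (e : nat -> set T).
Hypothesis beta0 : (0 < beta)%R.
Hypothesis me : forall n, atom_index mu beta n -> measurable (e n).
Hypothesis mue : forall n, atom_index mu beta n -> mu (e n) = beta%:E.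
Hypothesis trive : trivIset (atom_index mu beta) e.

Lemma atom_index_le m n : (m <= n)%N -> atom_index mu beta n -> atom_index mu beta m.
Proof.
by move=> mn; apply: le_trans; rewrite lee_fin ler_pM2r// ler_nat ltnS.
Qed.

(** The admissible indices form an initial segment, so those below [k] can be replaced by an ordinal
    type, which [step] requires. *)
Lemma atom_index_initial k :
  exists2 L, (L <= k)%N & forall n, (n < k)%N && atom_index mu beta n = (n < L)%N.
Proof.
elim: k => [|k [L Lk IH]]; first by exists 0%N.
have [ik|ik] := boolP (atom_index mu beta k).
  exists k.+1 => // n; have [nk|//] := ltnP n k.+1.
  by rewrite (atom_index_le _ ik).
exists L; first exact: leqW.
move=> n; rewrite -IH ltnS leq_eqVlt; have [->|] := eqVneq n k; last by [].
by rewrite (negPf ik) !andbF.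
Qed.

Local Notation cellstep := (cellstep (atom_index mu beta) e).
Local Notation cellstep_in := (cellstep_in trive).
Local Notation cellstep_out := (@cellstep_out _ T R (atom_index mu beta) e).
Local Notation cellstep_nneg_measurable := (cellstep_nneg_measurable me).
Local Notation le_cellstep := (@le_cellstep _ T R (atom_index mu beta) e).

(** [ri_integral] bounds the integral over [e n], here infinite, by a finite multiple of the
    norm. *)
Lemma cellstep_pinfty b n : (forall n, 0 <= b n) -> atom_index mu beta n -> b n = +oo ->
  N (of_nneg (cellstep b)) = +oo.
Proof.
move=> b0 idx_n bn; have mb := cellstep_nneg_measurable b0.
have [|C C0 /(_ _ mb)] := ri_integral N_ri (me idx_n); first by rewrite mue ?ltry.
have -> : \int[mu]_(x in e n) cellstep b x = +oo.
  rewrite (eq_integral (cst +oo)) => [|x /set_mem enx]; last by rewrite (cellstep_in b0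
    idx_n enx).
  by rewrite integral_cst ?mue//; [rewrite gt0_mulye// lte_fin|exact: me].
by have := ri_nneg_ge0 N_ri mb; case: (N _).
Qed.

Lemma sum_ord_lt (L K : nat) (F : nat -> R) :
  (\sum_(i < L | (i < K)%N) F i = \sum_(i < minn L K) F i)%R.
Proof.
have [KL|/ltnW LK] := leqP K L; first by rewrite (big_ord_widen L F).
by apply: eq_bigl => i; rewrite (leq_trans _ LK).
Qed.

(** The finite principle is applied to the first [L] terms. The Fatou property removes the cut-off
    of [a]; the lattice property restores the tail of [b]. *)
Lemma cellstep_majorized (a b : nat -> \bar R) : (forall n, 0 <= a n) -> (forall n, 0 <=
  b n) ->
  (forall m n, (m <= n)%N -> a n <= a m) ->
  (forall k, \sum_(n < k) a n <= \sum_(n < k) b n) ->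
  N (of_nneg (cellstep a)) <= N (of_nneg (cellstep b)).
Proof.
move=> a0 b0 nia sab.
have [[n idx_n bn]|H] := pselect (exists2 n, atom_index mu beta n & b n = +oo).
  by rewrite (cellstep_pinfty b0 idx_n bn) leey.
have bfin n : atom_index mu beta n -> b n \is a fin_num.
  by move=> idx_n; rewrite ge0_fin_numE// lt_neqAle leey andbT; apply/eqP => bn; apply:
    H; exists n.
(* A term of [a] is at most a partial sum of [a], hence at most a finite partial sum of [b]. *)
have afin n : atom_index mu beta n -> a n \is a fin_num.
  move=> idx_n; rewrite ge0_fin_numE//.
  apply: (@le_lt_trans _ _ (\sum_(k < n.+1) a k)).
    by rewrite big_ord_recr/= leeDr// sume_ge0.
  apply: le_lt_trans (sab n.+1) _; rewrite -ge0_fin_numE ?sume_ge0//.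
  apply/sum_fin_numP => k _ _; apply: bfin; apply: atom_index_le idx_n.
  by rewrite -ltnS.
pose ak k n := if (n < k)%N then a n else 0.
have ak0 k n : 0 <= ak k n by rewrite /ak; case: ifP.
have [nd cv] : nondecreasing_seq (fun k => N (of_nneg (cellstep (ak k)))) /\
    N (of_nneg (cellstep (ak k))) @[k --> \oo] --> N (of_nneg (cellstep a)).
  apply: (ri_fatou N_ri); first by move=> k; exact: cellstep_nneg_measurable.
    exact: cellstep_nneg_measurable.
  apply: aeW => x; split.
    move=> k1 k2 k12; apply: le_cellstep => // n _; rewrite /ak.
    by case: ltnP => [/leq_trans -> //|_]; case: ifP.
  have [[n idx_n enx]|nex] := pselect (exists2 n, atom_index mu beta n & e n x).
    rewrite (cellstep_in a0 idx_n enx); apply: cvg_near_cst; exists n.+1 => // k /= nk.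
    by rewrite (cellstep_in _ idx_n enx)// /ak nk.
  rewrite cellstep_out//; apply: cvg_near_cst; apply: nearW => k.
  by rewrite cellstep_out.
rewrite -(cvg_lim _ cv)//; apply: lime_le; first by apply/cvg_ex; eexists; exact: cv.
apply: nearW => k; have [L Lk LE] := atom_index_initial k.
have idxL n : (n < L)%N -> atom_index mu beta n by rewrite -LE => /andP[].
pose eL (i : 'I_L) := e i.
have trivL : trivIset setT eL.
  by move=> i j _ _ /trive ij; apply/val_inj; apply: ij; exact: idxL.
have meL i : measurable (eL i) by apply: me; exact: idxL.
have mueL i : mu (eL i) = beta%:E by apply: mue; exact: idxL.
have stepin (c : nat -> \bar R) x (i : 'I_L) : (forall n, 0 <= c n) -> eL i x -> cellstep
  c x = c i.
  by move=> c0; apply: cellstep_in => //; exact: idxL.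
have fineE (c : nat -> \bar R) k' : (forall n, atom_index mu beta n -> c n \is a fin_num) ->
    (k' <= L)%N -> (\sum_(i < k') fine (c i))%R%:E = \sum_(i < k') c i.
  move=> cfin kL; rewrite -sumEFin; apply: eq_bigr => i _; rewrite fineK// cfin// idxL//.
  exact: leq_trans kL.
apply: (@le_trans _ _ (N (of_nneg (step eL (fun i => fine (a i)))))).
  apply: (ri_le N_ri).
  - exact: cellstep_nneg_measurable.
  - by apply: step_nneg_measurable => // i; exact: fine_ge0.
  move=> x; have [[n idx_n enx]|nex] := pselect (exists2 n, atom_index mu beta n & e n x).
    rewrite (cellstep_in _ idx_n enx)// /ak; case: ifPn => nk.
      have nL : (n < L)%N by rewrite -LE nk.
      rewrite (@step_in _ _ _ _ eL trivL _ (Ordinal nL))//= fineK//; exact: afin.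
    by apply: (step_nneg_measurable _ _).2 => // i; exact: fine_ge0.
  rewrite cellstep_out//; apply: (step_nneg_measurable _ _).2 => // i; exact: fine_ge0.
apply: (@le_trans _ _ (N (of_nneg (step eL (fun i => fine (b i)))))).
  apply: (step_majorized N_ri meL mueL trivL).
  - by move=> i; exact: fine_ge0.
  - by move=> i; exact: fine_ge0.
  - move=> i j ij; apply: fine_le; [exact/afin/idxL|exact/afin/idxL|exact: nia].
  move=> K; rewrite !(@sum_ord_lt L K (fun n => fine (_ n))).
  by rewrite -lee_fin !fineE// geq_minl.
apply: (ri_le N_ri).
- by apply: step_nneg_measurable => // i; exact: fine_ge0.
- exact: cellstep_nneg_measurable.
move=> x; have [[i eix]|nex] := pselect (exists i, eL i x).
  by rewrite (step_in trivL _ eix) (stepin b x i b0 eix) fineK// bfin// idxL.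
by rewrite step_out//; apply: (cellstep_nneg_measurable b0).2.
Qed.

Lemma average_majorized r1 r2 : nneg_measurable r1 -> nneg_measurable r2 ->
  (forall s t : R, (0 <= s)%R -> (s <= t)%R -> r1 t <= r1 s) ->
  (forall t : R, (0 <= t)%R -> \int[halfline_measure R]_(x in `[0%R, t[) r1 x <=
    \int[halfline_measure R]_(x in `[0%R, t[) r2 x) ->
  N (of_nneg (cellstep (average beta r1))) <= N (of_nneg (cellstep (average beta r2))).
Proof.
move=> m1 m2 ni1 r12; apply: cellstep_majorized.
- by move=> n; apply: average_ge0 => //; exact: m1.2.
- by move=> n; apply: average_ge0 => //; exact: m2.2.
- exact: average_nonincreasing.
move=> k; rewrite !sum_average// lee_pmul2l ?lte_fin ?invr_gt0//.
by apply: r12; rewrite mulr_ge0// ltW.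
Qed.

End cells.

(** * Nonincreasing right-continuous functions and their dyadic approximation from below *)

Section profiles.
Context (R : realType).
Local Open Scope ereal_scope.
Local Notation Hm := (halfline_measure R).
Implicit Types r : measurableTypeR R -> \bar R.

(** The last clause is right-continuity on [[0, +oo[], in a form that also covers infinite
    values. *)
Definition profile r : Prop :=
  [/\ nneg_measurable r,
      forall s t : R, (0 <= s)%R -> (s <= t)%R -> r t <= r s &
      forall s t : R, (0 <= s)%R -> (0 <= t)%R -> s%:E < r t ->
        exists2 t' : R, (t < t')%R & s%:E < r t'].

Lemma rearr_profile d (T : measurableType d) (mu : {measure set T -> \bar R})
  (f : T -> xcomplex R) : xmeasurable f -> profile (rearr mu f).
Proof.
move=> mf; split; first exact: rearr_nneg_measurable.
  by move=> s t _ st; exact: rearr_nonincreasing.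
move=> s t s0 _; rewrite rearr_gt// => lt_t.
suff [t' tt' t'd] : exists2 t' : R, (t < t')%R & t'%:E < mu [set x | s%:E < xmod (f x)].
  by exists t' => //; rewrite rearr_gt.
case: (mu _) lt_t => [a| |]// ta.
  by exists ((t + a) / 2)%R; rewrite ?lte_fin; rewrite lte_fin in ta; lra.
by exists (t + 1)%R; rewrite ?ltry// ltrDl.
Qed.

Section halfline_cells.
Variable beta : R.
Hypothesis beta0 : (0 < beta)%R.

Lemma cell_truncn (t : R) : (0 <= t)%R -> cell beta (Num.truncn (t / beta)) t.
Proof.
move=> t0; rewrite /cell/= in_itv/= -ler_pdivlMr// -ltr_pdivrMr//.
by apply: truncn_itv; rewrite divr_ge0// ltW.
Qed.

Lemma cell_ge0 n t : cell beta n t -> (0 <= t)%R.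
Proof.
by rewrite /cell/= in_itv/= => /andP[+ _]; apply: le_trans; rewrite mulr_ge0// ltW.
Qed.

Lemma cell_homo m n (s t : R) : cell beta m s -> cell beta n t -> (s <= t)%R -> (m <= n)%N.
Proof.
rewrite /cell/= !in_itv/= => /andP[ms _] /andP[_ tn] st.
have := le_lt_trans (le_trans ms st) tn.
by rewrite ltr_pM2r// ltr_nat ltnS.
Qed.

Variable P : pred nat.
Hypothesis Pdown : forall m n, (m <= n)%N -> P n -> P m.

Lemma measurable_cellP n : P n -> measurable (cell beta n).
Proof. by move=> _; exact: measurable_cell. Qed.

Lemma trivIset_cellP : trivIset P (cell beta).
Proof. exact: sub_trivIset (trivIset_cell beta0). Qed.

Lemma cellstep_nonincreasing (a : nat -> \bar R) (s t : R) : (forall n, 0 <= a n) ->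
  (forall m n, (m <= n)%N -> a n <= a m) -> (0 <= s)%R -> (s <= t)%R ->
  cellstep P (cell beta) a t <= cellstep P (cell beta) a s.
Proof.
move=> a0 nia s0 st.
have [[n Pn ct]|H] := pselect (exists2 n, P n & cell beta n t); last first.
  by rewrite cellstep_out//; exact: (cellstep_nneg_measurable measurable_cellP a0).2.
have cs := cell_truncn s0; have kn := cell_homo cs ct st.
by rewrite (cellstep_in trivIset_cellP a0 Pn ct) (cellstep_in trivIset_cellP a0 (Pdown kn
  Pn) cs) nia.
Qed.

Lemma average_submajorized r : nneg_measurable r ->
  submajorized Hm Hm (cellstep P (cell beta) (average beta r)) r.
Proof.
move=> mr; apply: (@cellstep_submajorized _ _ _ _ _ Hm Hm P (cell beta) (cell beta)) => //.
- by move=> n _; exact: measurable_cell.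
- exact: trivIset_cellP.
- by move=> n _; exact: measurable_cell.
- exact: trivIset_cellP.
- by move=> n; apply: average_ge0 => //; exact: mr.2.
move=> n s Pn s0; rewrite [X in X * _ <= _]halfline_cell//.
by apply: jensen_excess => //; [exact: measurable_cell|exact: halfline_cell].
Qed.

Lemma le_integral_cellstep_average r (t : R) : nneg_measurable r ->
  (forall s t : R, (0 <= s)%R -> (s <= t)%R -> r t <= r s) -> (0 <= t)%R ->
  \int[Hm]_(x in `[0%R, t[) cellstep P (cell beta) (average beta r) x <=
  \int[Hm]_(x in `[0%R, t[) r x.
Proof.
move=> mr nir t0; apply: submajorized_integral => //; last exact: average_submajorized.
apply: cellstep_nneg_measurable; first exact: measurable_cellP.
by move=> n; apply: average_ge0 => //; exact: mr.2.
Qed.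

Lemma average_const r n c : (forall t, cell beta n t -> r t = c) -> average beta r n = c.
Proof.
move=> rc; rewrite -[RHS](average_cst beta0 c n) /average; congr (_ * _).
by apply: eq_integral => t /set_mem; exact: rc.
Qed.

Lemma average_ge r n : nneg_measurable r ->
  (forall s t : R, (0 <= s)%R -> (s <= t)%R -> r t <= r s) ->
  r (n.+1%:R * beta)%R <= average beta r n.
Proof.
move=> mr nir; rewrite -[leLHS](average_cst beta0 _ n); apply: le_average => //.
  by split=> // t; exact: mr.2.
move=> t ct; apply: nir; first exact: cell_ge0 ct.
by move: ct; rewrite /cell/= in_itv/= => /andP[_ /ltW].
Qed.

End halfline_cells.

Definition dyadic (m : nat) : R := ((2 ^+ m)^-1)%R.

Lemma dyadic_gt0 m : (0 < dyadic m)%R.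
Proof. by rewrite invr_gt0 exprn_gt0. Qed.

Lemma dyadic_small (eps : R) : (0 < eps)%R -> exists p, (dyadic p <= eps)%R.
Proof.
move=> e0; exists (Num.truncn eps^-1).+1; rewrite -[leRHS]invrK lef_pV2 ?posrE ?exprn_gt0
  ?invr_gt0//.
apply/ltW/(lt_le_trans (truncnS_gt _)).
by rewrite -natrX ler_nat ltnW// ltn_expl.
Qed.

(** The coarse mesh is a power of 2 times the fine one, so two cells with a common point are
    nested. *)
Lemma dyadic_cell_sub m p i n (t : R) : (m <= p)%N ->
  cell (dyadic p) i t -> cell (dyadic m) n t ->
  (n%:R * dyadic m <= i%:R * dyadic p)%R /\ (i.+1%:R * dyadic p <= n.+1%:R * dyadic m)%R.
Proof.
move=> mp; rewrite /cell/= !in_itv/= => /andP[it ti] /andP[nt tn].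
have mE : (dyadic m = (2 ^ (p - m))%:R * dyadic p)%R.
  by rewrite /dyadic natrX -{2}(subnK mp) exprD invfM mulrA divff ?mul1r//.
move: nt tn; rewrite mE !mulrA -!natrM => nt tn.
have d0 := dyadic_gt0 p.
have := le_lt_trans nt ti; rewrite ltr_pM2r// ltr_nat ltnS => h1.
have := le_lt_trans it tn; rewrite ltr_pM2r// ltr_nat => h2.
by split; rewrite ler_pM2r// ler_nat.
Qed.

Section lower.
Context d (T : measurableType d) (mu : {measure set T -> \bar R}).

(** Values at right end points keep this below a nonincreasing [r] and make it increase under dyadic
    refinement. Cells that stick out of [[0, mu T[] are dropped. *)
Definition lower (beta : R) r : measurableTypeR R -> \bar R :=
  cellstep (atom_index mu beta) (cell beta) (fun n => r (n.+1%:R * beta)%R).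

Lemma cell_itv_total (beta : R) n t : (0 < beta)%R -> atom_index mu beta n ->
  cell beta n t -> itv_total mu t.
Proof.
move=> b0 idx_n ct; split; first exact: cell_ge0 ct.
by apply: lt_le_trans idx_n; move: ct; rewrite /cell/= in_itv/= lte_fin => /andP[].
Qed.

Variable r : measurableTypeR R -> \bar R.
Hypothesis pr : profile r.

Let r0 t : 0 <= r t. Proof. by case: pr => -[]. Qed.
Let nir (s t : R) : (0 <= s)%R -> (s <= t)%R -> r t <= r s. Proof. by case: pr => _ + _;
  exact. Qed.

Lemma lower_nneg_measurable (beta : R) : (0 < beta)%R -> nneg_measurable (lower beta r).
Proof. by move=> b0; apply: cellstep_nneg_measurable => //; exact: measurable_cellP. Qed.

Lemma lower_in beta n t : (0 < beta)%R -> atom_index mu beta n -> cell beta n t ->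
  lower beta r t = r (n.+1%:R * beta)%R.
Proof. by move=> b0 idx_n ct; apply: cellstep_in => //; exact: trivIset_cellP. Qed.

Lemma lower_le (beta : R) t : (0 < beta)%R -> lower beta r t <= r t.
Proof.
move=> b0; have [[n idx_n ct]|H] := pselect (exists2 n, atom_index mu beta n & cell beta
  n t).
  rewrite (lower_in b0 idx_n ct); apply: nir; first exact: cell_ge0 ct.
  by move: ct; rewrite /cell/= in_itv/= => /andP[_ /ltW].
by rewrite /lower cellstep_out.
Qed.

Lemma lower_nonincreasing (beta : R) : (0 < beta)%R ->
  forall s t : R, (0 <= s)%R -> (s <= t)%R -> lower beta r t <= lower beta r s.
Proof.
move=> b0 s t s0 st; apply: cellstep_nonincreasing => //.
  by move=> m n; exact: atom_index_le.
move=> m n mn; apply: nir; first by rewrite mulr_ge0// ltW.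
by rewrite ler_pM2r// ler_nat ltnS.
Qed.

Lemma lower_dyadic_homo t : nondecreasing_seq (fun p => lower (dyadic p) r t).
Proof.
move=> m p mp; have dm := dyadic_gt0 m; have dp := dyadic_gt0 p.
have [[n idx_n ct]|H] := pselect (exists2 n, atom_index mu (dyadic m) n & cell (dyadic m)
  n t);
  last by rewrite /lower cellstep_out//; apply: (lower_nneg_measurable dp).2.
have cp := cell_truncn dp (cell_ge0 dm ct).
have [_ le_in] := dyadic_cell_sub mp cp ct.
have idx_p : atom_index mu (dyadic p) (Num.truncn (t / dyadic p)).
  by apply: le_trans idx_n; rewrite lee_fin.
rewrite (lower_in dm idx_n ct) (lower_in dp idx_p cp); apply: nir => //.
by rewrite mulr_ge0// ltW.
Qed.

(** If the limit were below [r t], right-continuity would give [t' > t] with [r t'] still above it;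
    a fine cell around [t] ends before [t'], so its right end value is too large. *)
Lemma lower_dyadic_cvg t : itv_total mu t -> lower (dyadic p) r t @[p --> \oo] --> r t.
Proof.
move=> [t0 tM]; have := ereal_nondecreasing_cvgn (@lower_dyadic_homo t).
set S := ereal_sup _ => cvS; suff -> : r t = S by [].
apply/eqP; rewrite eq_le; apply/andP; split; last first.
  by apply: ge_ereal_sup => _ [p _ <-]; exact/lower_le/dyadic_gt0.
rewrite leNgt; apply/negP => St.
have lowS p : lower (dyadic p) r t <= S by apply: ereal_sup_ubound; exists p.
have S0 : 0 <= S by apply: le_trans (lowS 0%N); apply: (lower_nneg_measurable (dyadic_gt0
  0)).2.
have [s Ss] : exists s : R, S = s%:E by case: S S0 St {cvS lowS} => [s| |]// _; [exists
  s|rewrite ltNge leey].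
rewrite Ss in St; have s0 : (0 <= s)%R by rewrite -lee_fin -Ss.
have [_ _ /(_ _ _ s0 t0 St)[t' tt' st']] := pr.
(* [eps] keeps the right end of the cell below both [t'] and the total measure, so that the cell is
   admissible. *)
have [eps e0 [epst epsM]] : exists2 eps : R, (0 < eps)%R & (t + eps <= t')%R /\ (t +
  eps)%:E <= mu setT.
  case: (mu setT) tM => [M| |]//; last by exists (t' - t)%R; rewrite ?leey ?subr_gt0//;
    split => //; rewrite addrC subrK.
  rewrite lte_fin => tM; exists (Num.min (t' - t) (M - t))%R; first by rewrite lt_min
    !subr_gt0 tt'.
  by rewrite lee_fin -!lerBrDl !ge_min !lexx orbT.
have [p pe] := dyadic_small e0; have dp := dyadic_gt0 p.
have cp := cell_truncn dp t0.
have up_le : ((Num.truncn (t / dyadic p)).+1%:R * dyadic p <= t + eps)%R.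
  rewrite -natr1 mulrDl mul1r lerD//.
  by move: cp; rewrite /cell/= in_itv/= => /andP[].
have idx_p : atom_index mu (dyadic p) (Num.truncn (t / dyadic p)).
  by apply: le_trans epsM; rewrite lee_fin.
have := lowS p; rewrite (lower_in dp idx_p cp) Ss leNgt => /negP; apply.
apply: (lt_le_trans st'); apply: nir; last exact: le_trans epst.
by rewrite mulr_ge0// ltW.
Qed.

End lower.
End profiles.

(** * Canonical norms in terms of rearrangements *)

Section nonatomic_representation.
Context d (T : measurableType d) (R : realType) (mu : {measure set T -> \bar R}).
Variable N : (T -> xcomplex R) -> \bar R.
Hypothesis N_ri : is_ri_norm mu N.
Variable sigma : T -> R.
Hypothesis sigma_mp : measure_preserving mu sigma.
Local Open Scope ereal_scope.
Local Notation Hm := (halfline_measure R).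

(** With [r] the rearrangement of [g] over the half-line, this unfolds to [transfer_nonatomic]. *)
Definition pullback (r : measurableTypeR R -> \bar R) (x : T) : \bar R :=
  r (sigma x) * (\1_(itv_total mu) (sigma x))%:E.

Lemma measurable_itv_total : measurable (itv_total mu : set (measurableTypeR R)).
Proof.
rewrite (_ : itv_total mu = `[0%R, +oo[%classic `&` (setT `&` [set t | (EFin t < cst (mu
  setT) t)%E])).
  apply: measurableI; first exact: measurable_itv.
  by apply: measurable_lte => //; exact: EFin_measurable.
by rewrite setTI; apply/seteqP; split=> t /=; rewrite in_itv/= andbT.
Qed.

Let msigma : measurable_fun setT (sigma : T -> measurableTypeR R).
Proof. by case: sigma_mp. Qed.

Lemma pullback_nneg_measurable r : nneg_measurable r -> nneg_measurable (pullback r).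
Proof.
move=> [mr r0]; split; last by move=> x; rewrite mule_ge0// lee_fin.
apply: emeasurable_funM; first exact: measurableT_comp.
apply/measurable_EFinP.
have m1 : measurable_fun setT (\1_(itv_total mu) : measurableTypeR R -> R).
  by apply: measurable_indic; exact: measurable_itv_total.
exact: (measurableT_comp m1 msigma).
Qed.

Lemma pullback_in r x : itv_total mu (sigma x) -> pullback r x = r (sigma x).
Proof. by move=> Sx; rewrite /pullback indicE mem_set// mule1. Qed.

Lemma pullback_out r x : ~ itv_total mu (sigma x) -> pullback r x = 0.
Proof. by move=> Sx; rewrite /pullback indicE memNset// mule0. Qed.

Section level.
Variable beta : R.
Hypothesis beta0 : (0 < beta)%R.

Definition sigma_cell (n : nat) : set T := sigma @^-1` cell beta n.

Lemma measurable_sigma_cell n : atom_index mu beta n -> measurable (sigma_cell n).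
Proof.
by move=> _; rewrite -[X in measurable X]setTI; apply: msigma => //; exact: measurable_cell.
Qed.

(** Admissible cells lie in [[0, mu T[], where [sigma] preserves measure; their preimages thus play
    the part of the atoms. *)
Lemma measure_sigma_cell n : atom_index mu beta n -> mu (sigma_cell n) = beta%:E.
Proof.
move=> idx_n; have sub : cell beta n `<=` itv_total mu by move=> t; exact: cell_itv_total.
case: sigma_mp => _ _ /(_ _ (measurable_cell beta n) sub) ->.
by rewrite -(halfline_cell beta0 n) /halfline_measure/= /mrestr setIidl// => t /(cell_ge0
  beta0) t0;
  rewrite /= in_itv/= t0.
Qed.

Lemma trivIset_sigma_cell : trivIset (atom_index mu beta) sigma_cell.
Proof.
move=> m n im jn [x [mx nx]].
by apply: (trivIset_cell beta0) => //; exists (sigma x).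
Qed.

Lemma cellstep_sigma (a : nat -> \bar R) x :
  cellstep (atom_index mu beta) sigma_cell a x = cellstep (atom_index mu beta) (cell
    beta) a (sigma x).
Proof. by []. Qed.

Lemma cellstep_sigma_le_pullback a r : (forall n, 0 <= a n) -> nneg_measurable r ->
  (forall t, cellstep (atom_index mu beta) (cell beta) a t <= r t) ->
  forall x, cellstep (atom_index mu beta) sigma_cell a x <= pullback r x.
Proof.
move=> a0 mr ar x; rewrite cellstep_sigma.
have [Sx|Sx] := pselect (itv_total mu (sigma x)); first by rewrite pullback_in.
rewrite pullback_out// cellstep_out// => -[n idx_n cn].
by apply: Sx; exact: cell_itv_total cn.
Qed.

End level.

Lemma lower_pullback_cvg (r : measurableTypeR R -> \bar R) : profile r ->
  N (of_nneg (fun x => lower mu (dyadic R p) r (sigma x))) @[p --> \oo] --> N (of_nneg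
    (pullback r)).
Proof.
move=> pr; have [mr nir _] := pr.
apply: (proj2 (ri_fatou N_ri _ _ _)) => //.
- move=> p; have [ml l0] := lower_nneg_measurable mu pr (dyadic_gt0 R p).
  by split; [exact: measurableT_comp|move=> x; exact: l0].
- exact: pullback_nneg_measurable.
apply: aeW => x; split; first by move=> m p mp; exact: lower_dyadic_homo.
have [Sx|Sx] := pselect (itv_total mu (sigma x)).
  by rewrite pullback_in//; exact: lower_dyadic_cvg.
rewrite pullback_out//; apply: cvg_near_cst; apply: nearW => p.
rewrite /lower cellstep_out// => -[n idx_n cn].
by apply: Sx; apply: cell_itv_total cn => //; exact: dyadic_gt0.
Qed.

Let avg (beta : R) r := cellstep (atom_index mu beta) (sigma_cell beta) (average beta r).

Let avg_nneg_measurable (beta : R) r : (0 < beta)%R -> nneg_measurable r ->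
  nneg_measurable (avg beta r).
Proof.
move=> b0 mr; apply: cellstep_nneg_measurable; first exact: measurable_sigma_cell.
by move=> n; apply: average_ge0 => //; exact: mr.2.
Qed.

(** The coarse averages [A] of [l] and [l] itself are both constant on the fine cells, so fine
    averaging recovers each of them. By Jensen the initial integrals of [A] are at most those of
    [l], and [l <= r]. *)
Lemma average_lower_le m p r : profile r -> (m <= p)%N ->
  N (of_nneg (avg (dyadic R m) (lower mu (dyadic R p) r))) <= N (of_nneg (pullback r)).
Proof.
move=> pr mp; have [mr nir _] := pr.
have dm := dyadic_gt0 R m; have dp := dyadic_gt0 R p.
have trm : trivIset (atom_index mu (dyadic R m)) (cell (dyadic R m)) by exact:
  trivIset_cellP.
have trp : trivIset (atom_index mu (dyadic R p)) (cell (dyadic R p)) by exact: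
  trivIset_cellP.
set l := lower mu (dyadic R p) r; have ml : nneg_measurable l by exact:
  lower_nneg_measurable.
have nilow := lower_nonincreasing mu pr dp.
pose A := cellstep (atom_index mu (dyadic R m)) (cell (dyadic R m)) (average (dyadic R m)
  l).
have a0 n : 0 <= average (dyadic R m) l n by apply: average_ge0 => //; exact: ml.2.
have mA : nneg_measurable A by apply: cellstep_nneg_measurable => //; exact:
  measurable_cellP.
have niA : forall s t : R, (0 <= s)%R -> (s <= t)%R -> A t <= A s.
  move=> s t; apply: cellstep_nonincreasing => //.
    by move=> i j; exact: atom_index_le.
  exact: average_nonincreasing.
have Aa0 n : 0 <= average (dyadic R p) A n by apply: average_ge0 => //; exact: mA.2.
apply: (@le_trans _ _ (N (of_nneg (avg (dyadic R p) A)))).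
  apply: (ri_le N_ri); [exact: avg_nneg_measurable|exact: avg_nneg_measurable|].
  move=> x; rewrite /avg cellstep_sigma -/A.
  have [[n idx_n cn]|H] := pselect (exists2 n, atom_index mu (dyadic R m) n & cell
    (dyadic R m) n (sigma x)); last first.
    rewrite /A cellstep_out//; apply: (avg_nneg_measurable dp mA).2.
  have cp := cell_truncn dp (cell_ge0 dm cn).
  set i := Num.truncn _ in cp.
  have [_ in_le] := dyadic_cell_sub mp cp cn.
  have idx_i : atom_index mu (dyadic R p) i by apply: le_trans idx_n; rewrite lee_fin.
  rewrite (cellstep_in (trivIset_sigma_cell dp) Aa0 idx_i cp).
  rewrite (@average_const _ _ dp A i (A (sigma x)))// => t ct.
  have [ni_le in_le'] := dyadic_cell_sub mp cp cn.
  have cnt : cell (dyadic R m) n t.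
    move: ct; rewrite /cell/= !in_itv/= => /andP[it ti].
    by rewrite (le_trans ni_le it) (lt_le_trans ti in_le').
  rewrite /A (cellstep_in trm a0 idx_n cnt).
  by rewrite (cellstep_in trm a0 idx_n cn).
apply: (@le_trans _ _ (N (of_nneg (avg (dyadic R p) l)))).
  apply: (average_majorized N_ri dp (@measurable_sigma_cell (dyadic R p))
    (@measure_sigma_cell _ dp)
    (trivIset_sigma_cell dp) mA ml niA) => t t0.
  exact: le_integral_cellstep_average.
have la0 n : 0 <= average (dyadic R p) l n by apply: average_ge0 => //; exact: ml.2.
apply: (ri_le N_ri); [exact: avg_nneg_measurable|exact: pullback_nneg_measurable|].
apply: cellstep_sigma_le_pullback => // t.
have [[n idx_n cn]|H] := pselect (exists2 n, atom_index mu (dyadic R p) n & cell (dyadic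
  R p) n t); last first.
  by rewrite cellstep_out//; exact: mr.2.
rewrite (cellstep_in trp la0 idx_n cn).
rewrite (@average_const _ _ dp l n (l t)); first exact: lower_le.
by move=> t' ct'; rewrite /l (lower_in pr dp idx_n ct') (lower_in pr dp idx_n cn).
Qed.

(* Approximated from below by step functions on finer dyadic grids, [r] becomes
   a finite sequence, which majorizes its averages over blocks. *)
Lemma average_pullback_le m r : profile r ->
  N (of_nneg (avg (dyadic R m) r)) <= N (of_nneg (pullback r)).
Proof.
move=> pr; have [mr nir _] := pr; have dm := dyadic_gt0 R m.
have ml p : nneg_measurable (lower mu (dyadic R p) r) by apply: lower_nneg_measurable =>
  //; exact: dyadic_gt0.
have cv : N (of_nneg (avg (dyadic R m) (lower mu (dyadic R p) r))) @[p --> \oo] -->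
    N (of_nneg (avg (dyadic R m) r)).
  apply: (proj2 (ri_fatou N_ri _ _ _)).
  - by move=> p; exact: avg_nneg_measurable.
  - exact: avg_nneg_measurable.
  apply: aeW => x.
  have [[n idx_n cn]|H] := pselect (exists2 n, atom_index mu (dyadic R m) n & cell
    (dyadic R m) n (sigma x)); last first.
    have avgout r' : avg (dyadic R m) r' x = 0 by exact: cellstep_out.
    split; first by move=> p q _ /=; rewrite !avgout.
    by apply: cvg_near_cst; apply: nearW => p; rewrite !avgout.
  have avgE r' : nneg_measurable r' -> avg (dyadic R m) r' x = average (dyadic R m) r' n.
    move=> mr'; apply: (cellstep_in (trivIset_sigma_cell dm)) => //.
    by move=> k; apply: average_ge0 => //; exact: mr'.2.
  split.
    move=> p q pq /=; rewrite (avgE _ (ml p)) (avgE _ (ml q)).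
    by apply: (le_average dm (ml p) (ml q)) => t _; exact: lower_dyadic_homo.
  rewrite (avgE _ mr).
  rewrite (_ : (fun p => _) = fun p => average (dyadic R m) (lower mu (dyadic R p) r) n);
    last first.
    by apply/funext => p; exact: avgE.
  (* Monotone convergence on one cell; as the cell is admissible, [lower] converges at each of its
     points. *)
  have cvI : \int[Hm]_(t in cell (dyadic R m) n) lower mu (dyadic R p) r t @[p --> \oo] -->
      \int[Hm]_(t in cell (dyadic R m) n) r t.
    rewrite [X in _ --> X](eq_integral (fun t => limn (fun p => lower mu (dyadic R p) r
      t))).
    apply: cvg_monotone_convergence.
    - exact: measurable_cell.
    - by move=> p; exact: measurable_funS (ml p).1.
    - by move=> p t _; exact: (ml p).2.
    - by move=> t _ p q pq; exact: lower_dyadic_homo.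
    move=> t /set_mem ct; apply/esym/cvg_lim => //.
    by apply: lower_dyadic_cvg => //; exact: cell_itv_total ct.
  exact: cvgeZl.
rewrite -(cvg_lim _ cv)//; apply: lime_le; first by apply/cvg_ex; eexists; exact: cv.
(* The comparison starts once the grid of [p] refines that of [m]. *)
by exists m => // p /= mp; exact: average_lower_le.
Qed.

(** [lower] of [r1] is below the averages of [r1], these are majorized by the averages of [r2],
    whose norm is at most that of [pullback r2]. Then the mesh tends to 0. *)
Lemma pullback_majorized r1 r2 : profile r1 -> profile r2 ->
  (forall t : R, (0 <= t)%R -> \int[Hm]_(x in `[0%R, t[) r1 x <= \int[Hm]_(x in `[0%R,
    t[) r2 x) ->
  N (of_nneg (pullback r1)) <= N (of_nneg (pullback r2)).
Proof.
move=> p1 p2 r12; have [m1 ni1 _] := p1; have [m2 ni2 _] := p2.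
have cv := lower_pullback_cvg p1.
rewrite -(cvg_lim _ cv)//; apply: lime_le; first by apply/cvg_ex; eexists; exact: cv.
apply: nearW => p; have dp := dyadic_gt0 R p.
apply: (@le_trans _ _ (N (of_nneg (avg (dyadic R p) r1)))).
  apply: (ri_le N_ri).
  - have [ml l0] := lower_nneg_measurable mu p1 dp.
    by split; [exact: measurableT_comp|move=> x; exact: l0].
  - exact: avg_nneg_measurable.
  move=> x; rewrite /avg cellstep_sigma; apply: le_cellstep.
  - by move=> n; exact: m1.2.
  - by move=> n; apply: average_ge0 => //; exact: m1.2.
  - by move=> n _; exact: average_ge.
apply: le_trans (average_pullback_le p p2).
exact: (average_majorized N_ri dp (@measurable_sigma_cell (dyadic R p))
  (@measure_sigma_cell _ dp)
    (trivIset_sigma_cell dp)).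
Qed.

(** The set where the pullback exceeds [s] is the preimage under [sigma] of [[0, D[] with [D] the
    measure of [{|f| > s}]; hence the pullback is equimeasurable with [|f|]. *)
Lemma pullback_rearr f : xmeasurable f -> N (of_nneg (pullback (rearr mu f))) = N f.
Proof.
move=> mf; rewrite -(ri_abs N_ri mf).
have mr := rearr_nneg_measurable mu mf.
have mx := xmod_nneg_measurable mf.
apply: (ri_equimeasurable N_ri) => //; first exact: pullback_nneg_measurable.
move=> s s0; pose E := [set t : R | (0 <= t)%R /\ t%:E < mu [set x | s%:E < xmod (f x)]].
have EE : E = [set t | t%:E < mu [set x | s%:E < xmod (f x)]] `&` `[0%R, +oo[.
  by apply/seteqP; split=> t /=; rewrite in_itv/= andbT => -[].
have mE : measurable (E : set (measurableTypeR R)).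
  rewrite EE; apply: measurableI; last exact: measurable_itv.
  rewrite -[X in measurable X]setTI.
  by apply: measurable_lte => //; exact: EFin_measurable.
have msup : measurable [set x | s%:E < xmod (f x)] by apply: measurable_gt; exact: mx.1.
have EM : E `<=` itv_total mu.
  move=> t [t0 td]; split=> //; apply: (lt_le_trans td).
  by apply: le_measure; rewrite ?inE//.
have -> : [set x | s%:E < pullback (rearr mu f) x] = sigma @^-1` E.
  apply/seteqP; split=> x /=.
    have [Sx|Sx] := pselect (itv_total mu (sigma x)).
      by rewrite pullback_in// rearr_gt// => h; split => //; exact: Sx.1.
    by rewrite pullback_out// lte_fin ltNge s0.
  by move=> Ex; rewrite pullback_in ?rearr_gt//; [exact: Ex.2|exact: EM].
case: sigma_mp => _ _ /(_ _ mE EM) ->.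
rewrite EE; exact: halfline_lt.
Qed.

End nonatomic_representation.

Section atomic_representation.
Context d (T : measurableType d) (R : realType) (mu : {measure set T -> \bar R}).
Variable N : (T -> xcomplex R) -> \bar R.
Hypothesis N_ri : is_ri_norm mu N.
Variables (beta : R) (e : nat -> set T).
Hypothesis beta_atoms : equal_atoms mu beta.
Hypothesis e_atoms : atom_enumeration mu beta e.
Local Open Scope ereal_scope.
Local Notation Hm := (halfline_measure R).

Let beta0 : (0 < beta)%R. Proof. by case: beta_atoms. Qed.

Let me n : atom_index mu beta n -> measurable (e n).
Proof. by case: e_atoms => + _ _ => /[apply] -[]. Qed.

Let mue n : atom_index mu beta n -> mu (e n) = beta%:E.
Proof. by case: e_atoms => + _ _ => /[apply]; case: beta_atoms => _ _; apply. Qed.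

Let trive : trivIset (atom_index mu beta) e.
Proof. by case: e_atoms. Qed.

Lemma measure_setI_atom E n : measurable E -> atom_index mu beta n ->
  mu (E `&` e n) = 0 \/ mu (E `&` e n) = beta%:E.
Proof.
move=> mE idx_n; have men := me idx_n.
have mEe : measurable (E `&` e n) by exact: measurableI.
have [He _ _] := e_atoms; have [_ _ Hn] := He n idx_n.
have [|diff0] := Hn _ mEe (@subIsetr _ _ _); [by left|right].
have <- : mu (E `&` e n) + mu (e n `\` (E `&` e n)) = beta%:E.
  rewrite -(mue idx_n) -[in RHS](setDUK (@subIsetr _ E (e n))).
  by apply/esym/measureU => //; [exact: measurableD|rewrite setDIK].
by rewrite [X in _ + X](_ : _ = 0) ?adde0.
Qed.

(** [mu E] is a series with terms [0] or [beta], so each partial sum is a multiple of [beta]. Stated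
    as a jump, the fact also covers infinite measure. *)
Lemma measure_atomic_jump E n : measurable E -> (n%:R * beta)%:E < mu E ->
  (n.+1%:R * beta)%:E <= mu E.
Proof.
move=> mE lt_n; pose P := atom_index mu beta.
pose U := \bigcup_(k in P) (E `&` e k).
have mU : measurable U by apply: bigcup_measurable => k Pk; apply: measurableI => //;
  exact: me.
have trU : trivIset P (fun k => E `&` e k) by exact: trivIset_setIl.
have muU : mu U = \sum_(k <oo | P k) mu (E `&` e k).
  rewrite /U measure_bigcup//; last by move=> k Pk; apply: measurableI => //; exact: me.
  by apply: eq_eseriesl => k; apply/idP/idP => [/set_mem|Pk]//; exact: mem_set.
have le_EU : mu E <= mu U.
  have [_ _ [A [mA A0 subA]]] := e_atoms.
  apply: (@le_trans _ _ (mu (U `|` A))).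
    apply: le_measure; rewrite ?inE//; first exact: measurableU.
    move=> x Ex; have [xU|xU] := pselect ((\bigcup_(k in P) e k) x).
      by left; case: xU => k Pk ekx; exists k.
    by right; exact: subA.
  apply: (le_trans (measureU2 _ mU mA)).
  by rewrite [X in _ + X](_ : _ = 0) ?adde0.
have le_UE : mu U <= mu E by apply: le_measure; rewrite ?inE// => x [k _ []].
have partial K : exists m : nat, \sum_(0 <= k < K | P k) mu (E `&` e k) = (m%:R * beta)%:E.
  elim: K => [|K [m IH]]; first by exists 0%N; rewrite big_nil mul0r.
  rewrite big_mkcond big_nat_recr//= -big_mkcond IH; case: ifPn => PK; last first.
    by exists m; rewrite adde0.
  case: (measure_setI_atom mE PK) => ->; first by exists m; rewrite adde0.
  by exists m.+1; rewrite -EFinD -natr1 mulrDl mul1r.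
apply: contrapT => /negP; rewrite -ltNge => lt_E.
have : mu E <= (n%:R * beta)%:E.
  apply: (le_trans le_EU); rewrite muU.
  apply: lime_le; first by apply: is_cvg_nneseries.
  apply: nearW => K; have [m mK] := partial K; rewrite mK.
  have : (m%:R * beta)%:E <= mu E.
    rewrite -mK; apply: le_trans le_UE; rewrite muU.
    by apply: nneseries_lim_ge.
  move=> /le_lt_trans/(_ lt_E); rewrite lte_fin ltr_pM2r// ltr_nat ltnS => mn.
  by rewrite lee_fin ler_pM2r// ler_nat.
by rewrite leNgt lt_n.
Qed.

(** With [r] the rearrangement of [g] over the half-line, this unfolds to [transfer_atomic]. *)
Definition atomic_average (r : measurableTypeR R -> \bar R) : T -> \bar R :=
  cellstep (atom_index mu beta) e (average beta r).

Lemma atomic_average_nneg_measurable r : nneg_measurable r -> nneg_measurable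
  (atomic_average r).
Proof.
move=> mr; apply: cellstep_nneg_measurable => //.
by move=> n; apply: average_ge0 => //; exact: mr.2.
Qed.

Lemma atomic_average_majorized r1 r2 : profile r1 -> profile r2 ->
  (forall t : R, (0 <= t)%R -> \int[Hm]_(x in `[0%R, t[) r1 x <= \int[Hm]_(x in `[0%R,
    t[) r2 x) ->
  N (of_nneg (atomic_average r1)) <= N (of_nneg (atomic_average r2)).
Proof. by move=> [m1 ni1 _] [m2 _ _]; exact: (average_majorized N_ri). Qed.

Lemma atomic_average_rearr f : xmeasurable f -> N (of_nneg (atomic_average (rearr mu f)))
  = N f.
Proof.
move=> mf; rewrite -(ri_abs N_ri mf).
have mr := rearr_nneg_measurable mu mf.
have mx := xmod_nneg_measurable mf.
have a0 n : 0 <= average beta (rearr mu f) n by apply: average_ge0 => //; exact: mr.2.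
apply: (ri_equimeasurable N_ri) => //; first exact: cellstep_nneg_measurable.
move=> s s0; set D := mu [set x | s%:E < xmod (f x)].
have mD : measurable [set x | s%:E < xmod (f x)] by apply: measurable_gt; exact: mx.1.
have dist_gt (s' : R) : measurable [set x | s'%:E < xmod (f x)] by apply: measurable_gt;
  exact: mx.1.
have nb0 n : (0 <= n%:R * beta)%R by rewrite mulr_ge0// ltW.
(* The distribution function of [f] jumps by multiples of [beta], so [rearr mu f] is constant on
   each cell. *)
have avgE n : average beta (rearr mu f) n = rearr mu f (n%:R * beta)%R.
  apply: average_const => // t ct.
  have [nt tn] : (n%:R * beta <= t)%R /\ (t < n.+1%:R * beta)%R.
    by move: ct; rewrite /cell/= in_itv/= => /andP.
  apply/eqP; rewrite eq_le rearr_nonincreasing//= leNgt; apply/negP => lt_r.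
  have [s' rE] : exists s' : R, rearr mu f t = s'%:E.
    case: (rearr mu f t) (rearr_ge0 mu f t) lt_r => [s'| |]// _; first by exists s'.
    by rewrite ltNge leey.
  have s'0 : (0 <= s')%R by rewrite -lee_fin -rE rearr_ge0.
  move: (lt_r); rewrite rE rearr_gt// => /(measure_atomic_jump (dist_gt s')) le_d.
  suff : s'%:E < rearr mu f t by rewrite rE ltxx.
  by rewrite rearr_gt//; apply: lt_le_trans le_d; rewrite lte_fin.
pose Q n := (n%:R * beta)%:E < D.
have Qidx n : Q n -> atom_index mu beta n.
  move=> /(measure_atomic_jump mD) h; apply: (le_trans h).
  by apply: le_measure; rewrite ?inE.
have -> : [set x | s%:E < atomic_average (rearr mu f) x] = \bigcup_(n in Q) e n.
  apply/seteqP; split=> x /=.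
    have [[n idx_n enx]|H] := pselect (exists2 n, atom_index mu beta n & e n x).
      rewrite /atomic_average (cellstep_in trive a0 idx_n enx) avgE rearr_gt// => Qn.
      by exists n.
    by rewrite /atomic_average cellstep_out// lte_fin ltNge s0.
  move=> [n Qn enx].
  by rewrite /atomic_average (cellstep_in trive a0 (Qidx n Qn) enx) avgE rearr_gt.
(* Writing [D] as the measure of a union of cells turns both sides into the same series of [beta]
   over [Q]. *)
have -> : D = Hm (\bigcup_(n in Q) cell beta n).
  rewrite -[LHS]halfline_lt ?measure_ge0// /halfline_measure/= /mrestr; congr
    lebesgue_measure.
  apply/seteqP; split=> t /= [] h t0; split => //; last first.
    case: h => n Qn ct; apply: lt_le_trans (measure_atomic_jump mD Qn).
    by move: ct; rewrite /cell/= in_itv/= lte_fin => /andP[].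
  have t0' : (0 <= t)%R by move: t0; rewrite in_itv/= andbT.
  have ct := cell_truncn beta0 t0'; exists (Num.truncn (t / beta)) => //.
  apply: le_lt_trans h; rewrite lee_fin.
  by move: ct; rewrite /cell/= in_itv/= => /andP[].
rewrite !measure_bigcup//.
- apply: eq_eseriesr => n; rewrite inE => Qn; rewrite mue; last exact: Qidx.
  by rewrite [RHS]halfline_cell.
- by move=> n _; exact: measurable_cell.
- exact: sub_trivIset (trivIset_cell beta0).
- by move=> n Qn; apply: me; exact: Qidx.
- exact: sub_trivIset Qidx trive.
Qed.

End atomic_representation.

Section canonical_norm.
Context d (T : measurableType d) (R : realType) (mu : {measure set T -> \bar R}).
Local Open Scope ereal_scope.
Local Notation Hm := (halfline_measure R).

(** [N] and [Nbar] become the same monotone functional of the rearrangement. From here on the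
    non-atomic and atomic cases are no longer distinguished. *)
Lemma canonical_norm_profile (N : (T -> xcomplex R) -> \bar R)
    (Nbar : (measurableTypeR R -> xcomplex R) -> \bar R) :
  is_ri_norm mu N -> is_canonical_norm mu N Nbar ->
  exists Phi : (measurableTypeR R -> \bar R) -> \bar R,
  [/\ forall r, profile r -> 0 <= Phi r,
      forall f, xmeasurable f -> N f = Phi (rearr mu f),
      forall g : measurableTypeR R -> xcomplex R, xmeasurable g -> Nbar g = Phi (rearr Hm
        g) &
      forall r1 r2, profile r1 -> profile r2 ->
        (forall t : R, (0 <= t)%R ->
          \int[Hm]_(x in `[0%R, t[) r1 x <= \int[Hm]_(x in `[0%R, t[) r2 x) ->
        Phi r1 <= Phi r2].
Proof.
move=> N_ri [[_ [sigma sigma_mp NbarE]]|[beta beta_atoms [e e_atoms NbarE]]].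
- exists (fun r => N (of_nneg (pullback mu sigma r))); split => //.
  + by move=> r [mr _ _]; apply: (ri_nneg_ge0 N_ri); exact: pullback_nneg_measurable.
  + by move=> f mf; rewrite pullback_rearr.
  + by move=> r1 r2 p1 p2; exact: pullback_majorized.
- exists (fun r => N (of_nneg (atomic_average mu beta e r))); split => //.
  + move=> r [mr _ _]; apply: (ri_nneg_ge0 N_ri); exact: (atomic_average_nneg_measurable
    beta_atoms e_atoms).
  + by move=> f mf; rewrite (atomic_average_rearr N_ri beta_atoms e_atoms).
  + by move=> r1 r2 p1 p2; exact: atomic_average_majorized.
Qed.

Lemma rearr_submajorized d1 d2 (T1 : measurableType d1) (T2 : measurableType d2)
    (mu1 : {measure set T1 -> \bar R}) (mu2 : {measure set T2 -> \bar R})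
    (f1 : T1 -> xcomplex R) (f2 : T2 -> xcomplex R) (t : R) :
  sigma_finite setT mu1 -> sigma_finite setT mu2 ->
  xmeasurable f1 -> xmeasurable f2 ->
  submajorized mu1 mu2 (fun x => xmod (f1 x)) (fun x => xmod (f2 x)) -> (0 <= t)%R ->
  \int[Hm]_(x in `[0%R, t[) rearr mu1 f1 x <= \int[Hm]_(x in `[0%R, t[) rearr mu2 f2 x.
Proof.
move=> sf1 sf2 mf1 mf2 sub t0; apply: submajorized_integral => //.
- exact: rearr_nneg_measurable.
- exact: rearr_nneg_measurable.
- by move=> x y _; exact: rearr_nonincreasing.
have sfH := @halfline_sigma_finite R.
move=> s s0.
rewrite (submajorized_equimeasurable sfH sf1 (rearr_nneg_measurable mu1 mf1)
  (xmod_nneg_measurable mf1) _ s0); last by move=> a a0; exact: rearr_equimeasurable.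
rewrite (submajorized_equimeasurable sfH sf2 (rearr_nneg_measurable mu2 mf2)
  (xmod_nneg_measurable mf2) _ s0); last by move=> a a0; exact: rearr_equimeasurable.
exact: sub.
Qed.

End canonical_norm.

(** * Transferring decompositions *)

Section level_sets.
Context (R : realType).
Local Open Scope ereal_scope.

Lemma integral_excess_pinfty d (T : measurableType d) (nu : {measure set T -> \bar R})
    (E : set T) (u : T -> \bar R) (s s1 : R) : measurable E -> nneg_measurable u ->
  (s < s1)%R -> nu (E `&` [set x | s1%:E < u x]) = +oo ->
  \int[nu]_(x in E) excess s (u x) = +oo.
Proof.
move=> mE [mu_ u0] s1s nuoo; apply/eqP; rewrite -leye_eq.
have mA : measurable (E `&` [set x | s1%:E < u x]).
  by apply: measurableI => //; exact: measurable_gt.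
have mex D : measurable_fun D (fun x => excess s (u x)).
  by apply: measurable_excess; exact: measurable_funS mu_.
apply: (@le_trans _ _ (\int[nu]_(x in E `&` [set x | s1%:E < u x]) excess s (u x))); last
  first.
  by apply: ge0_subset_integral => // x _; exact: excess_ge0.
apply: (@le_trans _ _ (\int[nu]_(x in E `&` [set x | s1%:E < u x]) cst (s1 - s)%:E x)).
  by rewrite integral_cst// nuoo gt0_muley// lte_fin subr_gt0.
apply: ge0_le_integral => //.
- by move=> x _; rewrite lee_fin subr_ge0 ltW.
- by move=> x [_ /= /ltW us]; rewrite EFinB le_max leeD2r.
Qed.

Lemma level_split d (T : measurableType d) (nu : {measure set T -> \bar R})
    (E : set T) (u v : T -> \bar R) (c : \bar R) :
  measurable E -> nneg_measurable u -> nneg_measurable v -> 0 <= c ->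
  (forall x, E x -> c <= u x + v x) ->
  exists ab : \bar R * \bar R, [/\ 0 <= ab.1, 0 <= ab.2, c <= ab.1 + ab.2,
    forall s, (0 <= s)%R -> nu E * excess s ab.1 <= \int[nu]_(x in E) excess s (u x) &
    forall s, (0 <= s)%R -> nu E * excess s ab.2 <= \int[nu]_(x in E) excess s (v x)].
Proof.
move=> mE mu_ mv c0 cuv.
have ex0 w s : 0 <= \int[nu]_(x in E) excess s (w x).
  by apply: integral_ge0 => x _; exact: excess_ge0.
have [nuE0|nuEN0] := eqVneq (nu E) 0.
  (* On a null set any splitting of [c] works, because [0 * +oo = 0]. *)
  exists (c, 0); split=> //=; first by rewrite adde0.
    by move=> s _; rewrite nuE0 mul0e.
  by move=> s _; rewrite nuE0 mul0e.
have nuE_ge0 : 0 <= nu E by exact: measure_ge0.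
case nuE : (nu E) => [b| |]; last by rewrite nuE in nuE_ge0.
  have b0 : (0 < b)%R by rewrite -lte_fin -nuE lt0e nuEN0 nuE_ge0.
  have bV0 : 0 <= b^-1%:E by rewrite lee_fin invr_ge0 ltW.
  have avg0 w : nneg_measurable w -> 0 <= b^-1%:E * \int[nu]_(x in E) w x.
    by move=> [_ w0]; apply: mule_ge0 => //; exact: integral_ge0.
  exists (b^-1%:E * \int[nu]_(x in E) u x, b^-1%:E * \int[nu]_(x in E) v x).
  split; [exact: avg0|exact: avg0| |by move=> s s0; exact: jensen_excess..].
  have mEu : measurable_fun E u by exact: measurable_funS mu_.1.
  have mEv : measurable_fun E v by exact: measurable_funS mv.1.
  have [_ u0] := mu_; have [_ v0] := mv.
  rewrite -ge0_muleDr ?integral_ge0// -ge0_integralD//.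
  apply: (@le_trans _ _ (b^-1%:E * \int[nu]_(x in E) cst c x)).
    by rewrite integral_cst// nuE muleCA -EFinM mulVf ?mule1// gt_eqF.
  rewrite lee_pmul2l ?lte_fin ?invr_gt0//; apply: ge0_le_integral => //.
  exact: emeasurable_funD.
(* The essential limsup of [w] on [E], with infinite measure as the notion of recurring; the value
   [0] is added to keep the supremum non-negative. *)
pose lim_sup (w : T -> \bar R) : \bar R := ereal_sup [set s%:E | s in
  [set s : R | s = 0%R \/ nu (E `&` [set x | s%:E < w x]) = +oo]].
have lim_sup0 w : 0 <= lim_sup w by apply: ereal_sup_ubound; exists 0%R => //; left.
have lim_supE w : nneg_measurable w -> forall s, (0 <= s)%R ->
    +oo * excess s (lim_sup w) <= \int[nu]_(x in E) excess s (w x).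
  (* If [s] is at least the limsup, the left side is [+oo * 0 = 0]; otherwise [w] exceeds some
     [s1 > s] on a set of infinite measure. *)
  move=> mw s s0; have [le_s|lt_s] := leP (lim_sup w) s%:E.
    have -> : excess s (lim_sup w) = 0.
      by apply/eqP; rewrite eq_le excess_ge0 andbT ge_max lexx andbT sube_le0.
    by rewrite mule0.
  have [_ [s1 Hs1 <-] lt_s1] := ereal_sup_gt lt_s; rewrite lte_fin in lt_s1.
  rewrite (@integral_excess_pinfty _ _ nu E w s s1) ?leey//.
  by case: Hs1 => // s10; move: lt_s1; rewrite s10 ltNge s0.
exists (lim_sup u, lim_sup v); split => //=; try by move=> s s0; exact: lim_supE.
rewrite leNgt; apply/negP => lt_c.
have [a aE] : exists a : R, lim_sup u = a%:E.
  case: (lim_sup u) (lim_sup0 u) lt_c => [a| |]// _; first by exists a.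
  by rewrite addye ?ltNge ?leey// -ltNye; exact: lt_le_trans (lim_sup0 v).
have [b bE] : exists b : R, lim_sup v = b%:E.
  case: (lim_sup v) (lim_sup0 v) lt_c => [b| |]// _; first by exists b.
  by rewrite aE addey ?ltNge ?leey.
have a0 : (0 <= a)%R by rewrite -lee_fin -aE.
have b0 : (0 <= b)%R by rewrite -lee_fin -bE.
have [s [t [sa tb st]]] : exists s t : R, [/\ (a < s)%R, (b < t)%R & (s + t)%:E < c].
  move: lt_c; rewrite aE bE -EFinD; case: c c0 {cuv} => [c| |]// _.
    rewrite lte_fin => abc; exists (a + (c - (a + b)) / 3)%R, (b + (c - (a + b)) / 3)%R.
    by rewrite lte_fin; split; lra.
  by move=> _; exists (a + 1)%R, (b + 1)%R; rewrite ltry; split=> //; lra.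
have fin_above w (r q : R) : lim_sup w = r%:E -> (r < q)%R ->
    nu (E `&` [set x | q%:E < w x]) < +oo.
  move=> wr rq; rewrite ltey; apply/eqP => H; suff : q%:E <= r%:E by rewrite lee_fin
    leNgt rq.
  by rewrite -wr; apply: ereal_sup_ubound; exists q => //; right.
(* As [s + t < c], the set [E] is covered by [{u > s}] and [{v > t}], whose parts in [E] have finite
   measure. *)
have : nu E < +oo.
  have mA w q : nneg_measurable w -> measurable (E `&` [set x | q < w x]).
    by move=> [mw _]; apply: measurableI => //; exact: measurable_gt.
  apply: (@le_lt_trans _ _ (nu ((E `&` [set x | s%:E < u x]) `|` (E `&` [set x | t%:E < v
    x])))).
    apply: le_measure; rewrite ?inE//; first by apply: measurableU; exact: mA.
    move=> x Ex; have [su|us] := ltP s%:E (u x); first by left.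
    right; split=> //=; rewrite ltNge; apply/negP => vt.
    have := le_lt_trans (cuv x Ex) (le_lt_trans (leeD us vt) st).
    by rewrite ltxx.
  apply: (le_lt_trans (measureU2 _ _ _)); [exact: mA|exact: mA|].
  by apply: lte_add_pinfty; [exact: fin_above aE _|exact: fin_above bE _].
by rewrite nuE.
Qed.

Variable delta : R.
Hypothesis delta0 : (0 < delta)%R.

Definition threshold (z : int) : R := expR (z%:~R * delta).

Lemma threshold_gt0 z : (0 < threshold z)%R.
Proof. exact: expR_gt0. Qed.

Lemma thresholdS z : threshold (z + 1) = (expR delta * threshold z)%R.
Proof. by rewrite /threshold intrD mulrDl mul1r expRD mulrC. Qed.

Lemma threshold_lt z1 z2 : (threshold z1 < threshold z2)%R = (z1 < z2)%R.
Proof. by rewrite ltr_expR ltr_pM2r// ltr_int. Qed.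

Lemma threshold_le z1 z2 : (threshold z1 <= threshold z2)%R = (z1 <= z2)%R.
Proof. by rewrite ler_expR ler_pM2r// ler_int. Qed.

Definition band (z : int) : set (\bar R) :=
  `](threshold z)%:E, (threshold (z + 1))%:E]%classic.

(** The bands and the point [+oo] are enumerated by the codes of [option int], so that [cellstep]
    applies; a number that codes nothing gives the empty set. The value 0 lies in no level. *)
Definition level (n : nat) : set (\bar R) :=
  match @pickle_inv (option int) n with
  | Some (Some z) => band z
  | Some None => [set +oo]
  | None => set0
  end.

Definition level_inf (n : nat) : \bar R :=
  match @pickle_inv (option int) n with
  | Some (Some z) => (threshold z)%:E
  | Some None => +oo
  | None => 0
  end.

Lemma measurable_level n : measurable (level n).
Proof.
by rewrite /level; case: pickle_inv => [[z|]|]//; exact: emeasurable_itv.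
Qed.

Lemma level_inf_ge0 n : 0 <= level_inf n.
Proof.
rewrite /level_inf; case: pickle_inv => [[z|]|]//.
by rewrite lee_fin ltW// threshold_gt0.
Qed.

Lemma level_inf_le n r : level n r -> level_inf n <= r.
Proof.
rewrite /level /level_inf; case: pickle_inv => [[z|]|]//= => [|->//].
by rewrite /band/= in_itv/= => /andP[/ltW].
Qed.

Lemma le_level_inf n r : level n r -> r <= (expR delta)%:E * level_inf n.
Proof.
rewrite /level /level_inf; case: pickle_inv => [[z|]|]//= => [|->].
  by rewrite /band/= in_itv/= thresholdS EFinM => /andP[].
by rewrite gt0_muley// lte_fin expR_gt0.
Qed.

Lemma level_trivIset : trivIset setT level.
Proof.
have band_disj z1 z2 r : band z1 r -> band z2 r -> (z1 <= z2)%R.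
  rewrite /band/= !in_itv/= => /andP[h1 _] /andP[_ h2].
  by have := lt_le_trans h1 h2; rewrite lte_fin threshold_lt ltzD1.
move=> m n _ _ [r []]; rewrite /level.
case Em : (pickle_inv m) => [i|]//; case En : (pickle_inv n) => [j|]//.
have mE := @pickle_invK (option int) m; rewrite Em /= in mE.
have nE := @pickle_invK (option int) n; rewrite En /= in nE.
move=> ri rj; rewrite -mE -nE; congr pickle.
case: i ri {Em mE} => [z1|]; case: j rj {En nE} => [z2|]//=.
- by move=> h2 h1; congr Some; apply: le_anti; rewrite (band_disj _ _ _ h1 h2) (band_disj
  _ _ _ h2 h1).
- by move=> ->; rewrite /band/= in_itv/= andbF.
- by move=> + roo; rewrite roo /band/= in_itv/= andbF.
Qed.

Lemma level_cover r : 0 < r -> exists n, level n r.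
Proof.
case: r => [r| |]//; last first.
  by move=> _; exists (pickle (None : option int)); rewrite /level pickleK_inv.
(* Bands are open on the left and closed on the right, hence the ceiling minus one instead of the
   floor. *)
rewrite lte_fin => r0; exists (pickle (Some (Num.ceil (ln r / delta) - 1)%R : option int)).
rewrite /level pickleK_inv /band/= in_itv/= !lte_fin lee_fin /threshold subrK.
have rE : r = expR (ln r) by rewrite lnK.
rewrite [X in (_ < X <= _)%R]rE ltr_expR ler_expR -ltr_pdivlMr// -ler_pdivrMr//.
exact: ceil_itv.
Qed.

End level_sets.

Section decomposition.
Context (R : realType) d1 d2 (T1 : measurableType d1) (T2 : measurableType d2).
Variables (nu1 : {measure set T1 -> \bar R}) (nu2 : {measure set T2 -> \bar R}).
Local Open Scope ereal_scope.
Variables (phi u v : T1 -> \bar R) (psi : T2 -> \bar R).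
Hypothesis mphi : nneg_measurable phi.
Hypothesis mu : nneg_measurable u.
Hypothesis mv : nneg_measurable v.
Hypothesis mpsi : nneg_measurable psi.
Hypothesis phi_psi : forall s : R, (0 <= s)%R ->
  nu1 [set x | s%:E < phi x] = nu2 [set y | s%:E < psi y].
Hypothesis phi_uv : forall x, phi x <= u x + v x.

(** [{phi > m + n}] is covered by [{u > m}] and [{v > n}]. This treats the case where no threshold
    has finite measure above it. *)
Lemma pinfty_dichotomy : (forall n : nat, nu1 [set x | n%:R%:E < phi x] = +oo) ->
  (forall n : nat, nu1 [set x | n%:R%:E < u x] = +oo) \/
  (forall n : nat, nu1 [set x | n%:R%:E < v x] = +oo).
Proof.
move=> H; have [|/existsNP[m /eqP um]] := pselect (forall n : nat, nu1 [set x | n%:R%:E <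
  u x] = +oo); first by left.
right=> n; apply/eqP; rewrite -leye_eq leNgt; apply/negP => vn.
have : nu1 [set x | (m + n)%:R%:E < phi x] < +oo.
  apply: (@le_lt_trans _ _ (nu1 ([set x | m%:R%:E < u x] `|` [set x | n%:R%:E < v x]))).
    apply: le_measure; rewrite ?inE.
    - by apply: measurable_gt; exact: mphi.1.
    - by apply: measurableU; apply: measurable_gt; [exact: mu.1|exact: mv.1].
    move=> x /= mnx; have [?|um'] := ltP m%:R%:E (u x); first by left.
    right=> /=; rewrite ltNge; apply/negP => vn'.
    have := lt_le_trans mnx (le_trans (phi_uv x) (leeD um' vn')).
    by rewrite -EFinD -natrD ltxx.
  apply: (le_lt_trans (measureU2 _ _ _)).
  - by apply: measurable_gt; exact: mu.1.
  - by apply: measurable_gt; exact: mv.1.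
  - by apply: lte_add_pinfty => //; rewrite ltey.
by rewrite H.
Qed.

Lemma submajorized_pinfty (w : T1 -> \bar R) : nneg_measurable w ->
  (forall n : nat, nu1 [set x | n%:R%:E < w x] = +oo) ->
  forall g : T2 -> \bar R, submajorized nu2 nu1 g w.
Proof.
move=> mw H g s s0; rewrite (@integral_excess_pinfty _ _ _ nu1 setT w s (Num.truncn
  s).+1%:R) ?leey//.
  by rewrite truncnS_gt.
by rewrite setTI.
Qed.

Variable delta : R.
Hypothesis delta0 : (0 < delta)%R.
Local Notation threshold := (threshold delta).

Lemma band_distribution d (T : measurableType d) (nu : {measure set T -> \bar R})
    (w : T -> \bar R) z : nneg_measurable w ->
  nu [set x | (threshold z)%:E < w x] =
  nu (w @^-1` band delta z) + nu [set x | (threshold (z + 1))%:E < w x].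
Proof.
move=> [mw _]; rewrite -measureU//.
- congr (nu _); apply/seteqP; split=> x /=; rewrite /band/= in_itv/=.
    by move=> ->; have [?|?] := leP (w x) (threshold (z + 1))%:E; [left|right].
  case=> [/andP[]//|]; apply: lt_trans; rewrite lte_fin threshold_lt//.
  by rewrite ltzD1.
- by rewrite -[X in measurable X]setTI; apply: mw => //; exact: emeasurable_itv.
- exact: measurable_gt.
- apply/seteqP; split=> x //= []; rewrite /band/= in_itv/= => /andP[_ h].
  by rewrite ltNge h.
Qed.

(** A band is a difference of two superlevel sets; finiteness allows cancelling the measure of the
    smaller one. *)
Lemma eq_measure_band z : nu1 [set x | (threshold (z + 1))%:E < phi x] < +oo ->
  nu2 (psi @^-1` band delta z) = nu1 (phi @^-1` band delta z).
Proof.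
move=> fin_z; have t0 := threshold_gt0 delta.
have := phi_psi (ltW (t0 z)).
rewrite (band_distribution nu1 z mphi) (band_distribution nu2 z mpsi).
rewrite -(phi_psi (ltW (t0 (z + 1)%R))).
have cfin : nu1 [set x | (threshold (z + 1))%:E < phi x] \is a fin_num.
  by rewrite ge0_fin_numE.
move=> /(congr1 (fun r => r - nu1 [set x | (threshold (z + 1))%:E < phi x])).
by rewrite !addeK.
Qed.

Lemma pinfty_bigcap d (T : measurableType d) (w : T -> \bar R) (K : R) :
  w @^-1` [set +oo] = \bigcap_(n : nat) [set x | (K + n%:R)%:E < w x].
Proof.
apply/seteqP; split=> x /=; first by move=> wx n _ /=; rewrite wx ltry.
move=> H; case wx : (w x) => [r| |]//.
- have := H (Num.truncn (r - K)).+1 Logic.I; rewrite /= wx lte_fin ltNge => /negP; case.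
  by rewrite -lerBlDl ltW// truncnS_gt.
- by have := H 0%N Logic.I; rewrite /= wx.
Qed.

Lemma eq_measure_pinfty (K : R) : (0 <= K)%R -> nu1 [set x | K%:E < phi x] < +oo ->
  nu2 (psi @^-1` [set +oo]) = nu1 (phi @^-1` [set +oo]).
Proof.
move=> K0 fin_K.
have cvg_pinfty d (T : measurableType d) (nu : {measure set T -> \bar R}) w :
    nneg_measurable w -> nu [set x | K%:E < w x] < +oo ->
    nu [set x | (K + n%:R)%:E < w x] @[n --> \oo] --> nu (w @^-1` [set +oo]).
  move=> [mw _] finw; rewrite (pinfty_bigcap w K).
  apply: (@nonincreasing_cvg_mu _ _ _ nu (fun n => [set x | (K + n%:R)%:E < w x])).
  - by rewrite /= addr0.
  - by move=> n; exact: measurable_gt.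
  - by apply: bigcap_measurable => // n _; exact: measurable_gt.
  - move=> m n mn; apply/subsetPset => x /=; apply: le_lt_trans.
    by rewrite lee_fin lerD2l ler_nat.
have c1 := cvg_pinfty _ _ nu1 phi mphi fin_K.
have c2 : nu2 [set x | (K + n%:R)%:E < psi x] @[n --> \oo] --> nu2 (psi @^-1` [set +oo]).
  by apply: cvg_pinfty => //; rewrite -phi_psi.
apply: (cvg_unique _ c2) => //.
rewrite (_ : (fun n => _) = (fun n : nat => nu1 [set x | (K + n%:R)%:E < phi x]))//.
by apply/funext => n; rewrite phi_psi// addr_ge0.
Qed.

(* Raising [psi] to the first threshold above which [phi] has finite
   distribution function makes it no more spread out than [phi] level by level,
   even though below that threshold equimeasurability gives no control. *)
Lemma level_domination : (exists z, nu1 [set x | (threshold z)%:E < phi x] < +oo) ->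
  exists K : R, (0 <= K)%R /\ forall n,
    nu2 ((fun y => maxe (psi y) K%:E) @^-1` level delta n) <= nu1 (phi @^-1` level delta n).
Proof.
move=> [z0 fin_z0]; have t0 z : (0 <= threshold z)%R by rewrite ltW// threshold_gt0.
have fin_above z z' : (z <= z')%R -> nu1 [set x | (threshold z)%:E < phi x] < +oo ->
    nu1 [set x | (threshold z')%:E < phi x] < +oo.
  move=> zz'; apply: le_lt_trans; apply: le_measure; rewrite ?inE;
    try by apply: measurable_gt; exact: mphi.1.
  by move=> x /=; apply: le_lt_trans; rewrite lee_fin threshold_le.
have pinf K : (0 <= K)%R -> nu2 ((fun y => maxe (psi y) K%:E) @^-1` [set +oo]) <= nu1
  (phi @^-1` [set +oo]).
  move=> K0; rewrite -(eq_measure_pinfty (t0 z0) fin_z0) le_eqVlt; apply/orP; left;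
    apply/eqP.
  congr (nu2 _); apply/seteqP; split=> y /= h; last by rewrite h maxye.
  by move: h; rewrite maxEle; case: ifP.
have [|/existsNP[z1 /negP]] := pselect (forall z, nu1 [set x | (threshold z)%:E < phi x]
  < +oo).
  move=> fin_all; exists 0%R; split => // n; rewrite /level; case: pickle_inv => [[z|]|].
  - rewrite -eq_measure_band// le_eqVlt; apply/orP; left; apply/eqP.
    congr (nu2 _); apply/seteqP; split=> y /=; rewrite (max_idPl _)//; exact: mpsi.2.
  - exact: pinf.
  - by rewrite !preimage_set0 !measure0.
rewrite -leNgt leye_eq => /eqP inf_z1.
(* [J] is the last index with infinite measure above its threshold; it lies between [z1] and
   [z0]. *)
have [J [infJ finJ]] : exists J, nu1 [set x | (threshold J)%:E < phi x] = +oo /\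
    nu1 [set x | (threshold (J + 1))%:E < phi x] < +oo.
  have z10 : (z1 <= z0)%R.
    rewrite leNgt; apply/negP => /ltW/fin_above/(_ fin_z0).
    by rewrite inf_z1.
  have ex : exists n : nat, nu1 [set x | (threshold (z1 + n%:Z))%:E < phi x] < +oo.
    exists `|z0 - z1|%N; rewrite gez0_abs ?subr_ge0//.
    by rewrite (addrC z1) subrK.
  case: (ex_minnP ex) => [[|n]]; first by rewrite addr0 inf_z1.
  move=> fin_n minn; exists (z1 + n%:Z)%R; split; last first.
    by rewrite (_ : (z1 + n%:Z + 1 = z1 + n.+1%:Z)%R)//; lia.
  apply/eqP; rewrite -leye_eq leNgt; apply/negP => /minn.
  by rewrite ltnn.
exists (threshold (J + 1)); split => // n; rewrite /level; case: pickle_inv => [[z|]|];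
  last 2 first.
- exact: pinf.
- by rewrite !preimage_set0 !measure0.
(* The raised [psi] is at least [threshold (J + 1)], the right end of band [J]. So it misses the
   bands below [J]; band [J] has infinite measure for [phi]; above [J] the measures of the original
   bands agree. *)
have [zJ|Jz] := ltP z J.
  rewrite [X in nu2 X](_ : _ = set0) ?measure0//; apply/seteqP; split=> y //=.
  rewrite /band/= in_itv/= => /andP[_]; rewrite ge_max => /andP[_].
  by rewrite lee_fin threshold_le// lerD2r leNgt zJ.
have [->|zNJ] := eqVneq z J.
  suff -> : nu1 (phi @^-1` band delta J) = +oo by rewrite leey.
  move: infJ; rewrite band_distribution//.
  case: (nu1 (phi @^-1` _)) (measure_ge0 nu1 (phi @^-1` band delta J)) => [r| |]// _.
  by case: (nu1 _) finJ (measure_ge0 nu1 [set x | (threshold (J + 1))%:E < phi x]).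
have Jz1 : (J + 1 <= z)%R by rewrite lezD1 lt_neqAle eq_sym zNJ.
rewrite -eq_measure_band; last by apply: fin_above finJ; rewrite lerD2r.
apply: le_measure; rewrite ?inE.
- have mm : measurable_fun setT (fun y => maxe (psi y) (threshold (J + 1))%:E).
    by apply: measurable_maxe => //; exact: mpsi.1.
  by rewrite -[X in measurable X]setTI; apply: mm => //; exact: emeasurable_itv.
- by rewrite -[X in measurable X]setTI; apply: mpsi.1 => //; exact: emeasurable_itv.
move=> y /=; rewrite /band/= !in_itv/= lt_max ge_max => /andP[+ /andP[-> _]].
case/orP => [->//|].
by rewrite lte_fin threshold_lt// ltNge Jz1.
Qed.

Lemma submajorized_decomposition : exists G H : T2 -> \bar R,
  [/\ nneg_measurable G, nneg_measurable H,
      forall y, psi y <= (expR delta)%:E * (G y + H y),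
      submajorized nu2 nu1 G u & submajorized nu2 nu1 H v].
Proof.
have e0 : (0 < expR delta)%R by exact: expR_gt0.
have sub0 w : submajorized nu2 nu1 (cst 0) w.
  move=> s s0; rewrite integral0_eq; first by apply: integral_ge0 => x _; exact: excess_ge0.
  by move=> y _; rewrite excess0.
have [|noinf] := pselect (forall n : nat, nu1 [set x | n%:R%:E < phi x] = +oo).
  (* Whichever of [u], [v] has infinite distribution at every height submajorizes all functions, so
     it takes all of [psi]. *)
  move=> /pinfty_dichotomy[] inf_uv.
  - exists (cst +oo), (cst 0); split => //; try by split => // y; rewrite leey.
    + by move=> y; rewrite adde0 gt0_muley ?leey// lte_fin.
    + exact: submajorized_pinfty.
  - exists (cst 0), (cst +oo); split => //; try by split => // y; rewrite leey.
    + by move=> y; rewrite add0e gt0_muley ?leey// lte_fin.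
    + exact: submajorized_pinfty.
have [K [K0 dom]] : exists K : R, (0 <= K)%R /\ forall n,
    nu2 ((fun y => maxe (psi y) K%:E) @^-1` level delta n) <= nu1 (phi @^-1` level delta n).
  apply: level_domination; move/existsNP: noinf => [n /eqP]; rewrite -ltey => fin_n.
  (* By [1 + x <= expR x] the threshold with this index is at least [n]. *)
  exists (Num.ceil (n%:R / delta)); apply: le_lt_trans fin_n.
  apply: le_measure; rewrite ?inE; try by apply: measurable_gt; exact: mphi.1.
  move=> x /=; apply: le_lt_trans; rewrite lee_fin.
  apply: (@le_trans _ _ (n%:R / delta * delta)%R); first by rewrite divfK// gt_eqF.
  apply: (@le_trans _ _ ((Num.ceil (n%:R / delta))%:~R * delta)%R).
    by rewrite ler_pM2r// ceil_ge.
  apply: le_trans (expR_ge1Dx _).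
  by rewrite lerDr.
set psi' := (fun y => maxe (psi y) K%:E) in dom.
have mpsi' : measurable_fun setT psi' by apply: measurable_maxe => //; exact: mpsi.1.
have mE n : measurable (phi @^-1` level delta n).
  by rewrite -[X in measurable X]setTI; apply: mphi.1 => //; exact: measurable_level.
have mF n : measurable (psi' @^-1` level delta n).
  by rewrite -[X in measurable X]setTI; apply: mpsi' => //; exact: measurable_level.
pose P : pred nat := xpredT.
have trivE : trivIset P (fun n => phi @^-1` level delta n).
  by move=> m n _ _ [x [xm xn]]; apply: (level_trivIset delta0) => //; exists (phi x).
have trivF : trivIset P (fun n => psi' @^-1` level delta n).
  by move=> m n _ _ [x [xm xn]]; apply: (level_trivIset delta0) => //; exists (psi' x).
have split_n n := @level_split _ _ _ nu1 (phi @^-1` level delta n) u v (level_inf delta n)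
  (mE n) mu mv (level_inf_ge0 _ n) (fun x h => le_trans (level_inf_le h) (phi_uv x)).
have {}[ab abP] := choice split_n.
have a0 n : 0 <= (ab n).1 by case: (abP n).
have b0 n : 0 <= (ab n).2 by case: (abP n).
exists (cellstep P (fun n => psi' @^-1` level delta n) (fun n => (ab n).1)),
  (cellstep P (fun n => psi' @^-1` level delta n) (fun n => (ab n).2)); split.
- by apply: cellstep_nneg_measurable.
- by apply: cellstep_nneg_measurable.
- move=> y; have le_psi' : psi y <= psi' y by rewrite le_max lexx.
  (* Where [psi'] vanishes no level applies, and the bound is trivial. *)
  apply: (le_trans le_psi'); have [y0|] := leP (psi' y) 0.
    apply: (le_trans y0); apply: mule_ge0; first by rewrite lee_fin ltW.
    by apply: adde_ge0; apply: (cellstep_nneg_measurable (fun n _ => mF n) _).2.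
  move=> /(level_cover delta0)[n yn].
  rewrite (cellstep_in trivF a0 (isT : P n) yn) (cellstep_in trivF b0 (isT : P n) yn).
  apply: (le_trans (le_level_inf yn)); rewrite lee_pmul2l ?lte_fin//.
  by case: (abP n).
- apply: (@cellstep_submajorized _ _ _ _ _ nu1 nu2 P (fun n => phi @^-1` level delta n))
  => //.
  (* [dom] allows [nu1] of the level set of [phi] to be replaced by the smaller [nu2] of the level
     set of [psi']. *)
  move=> n s _ s0; have [_ _ _ + _] := abP n => /(_ s s0); apply: le_trans.
  by rewrite lee_wpmul2r ?excess_ge0.
- apply: (@cellstep_submajorized _ _ _ _ _ nu1 nu2 P (fun n => phi @^-1` level delta n))
  => //.
  move=> n s _ s0; have [_ _ _ _] := abP n => /(_ s s0); apply: le_trans.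
  by rewrite lee_wpmul2r ?excess_ge0.
Qed.

End decomposition.

(** * The sum norm *)

Section splitting.
Context d (T : measurableType d) (R : realType).
Local Open Scope ereal_scope.

Definition xscaler (theta : T -> R) (f : T -> xcomplex R) (x : T) : xcomplex R :=
  xscale (Complex (theta x) 0%R) (f x).

Lemma xmod_xscaler theta f x : (0 <= theta x)%R ->
  xmod (xscaler theta f x) = (theta x)%:E * xmod (f x).
Proof.
rewrite /xscaler; case: (f x) => [[a b]|] t0 /=.
  rewrite -EFinM; congr EFin.
  rewrite !mul0r subr0 addr0 !exprMn -mulrDr sqrtrM ?sqr_ge0// sqrtr_sqr ger0_norm//.
case: eqP => [[->]|/eqP tN0].
  by rewrite /= expr0n addr0 sqrtr0 mul0e.
rewrite gt0_muley// lte_fin lt_neqAle t0 andbT.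
by apply: contraNneq tN0 => <-.
Qed.

(** At infinite values of [f]: [theta] and [1 - theta] are not both zero, so a summand stays
    infinite. *)
Lemma xadd_xscaler (theta : T -> R) f x :
  xadd (xscaler theta f x) (xscaler (fun x => 1 - theta x)%R f x) = f x.
Proof.
rewrite /xscaler; case: (f x) => [[a b]|] /=.
  apply: (f_equal Some); apply/eqP; rewrite eq_complex /=.
  by apply/andP; split; apply/eqP; lra.
case: eqP => [[->]|//]; rewrite ifF//; apply/eqP => -[].
by rewrite subr0; exact/eqP/oner_neq0.
Qed.

Lemma xscaler_xmeasurable (theta : T -> R) f : measurable_fun setT theta ->
  xmeasurable f -> xmeasurable (xscaler theta f).
Proof.
move=> mt [mN mRe mIm]; split.
- rewrite (_ : [set x | _] = [set x | f x = None] `&` (setT `&` theta @^-1` [set~ 0%R])).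
    by apply: measurableI => //; apply: mt => //; exact: measurableC.
  rewrite setTI; apply/seteqP; split=> x /=; rewrite /xscaler; case: (f x) => [a|] /=.
  + by [].
  + by case: eqP => // H _; split => // t0; apply: H; rewrite t0.
  + by case.
  + by case: eqP => // -[t0] [].
- rewrite (_ : (fun x => _) = (fun x => theta x * complex.Re (xfin (f x)))%R).
    exact: measurable_funM.
  apply/funext => x; rewrite /xscaler; case: (f x) => [[a b]|] /=.
    by rewrite mul0r subr0.
  by case: eqP => //= _; rewrite mulr0.
- rewrite (_ : (fun x => _) = (fun x => theta x * complex.Im (xfin (f x)))%R).
    exact: measurable_funM.
  apply/funext => x; rewrite /xscaler; case: (f x) => [[a b]|] /=.
    by rewrite mul0r addr0.
  by case: eqP => //= _; rewrite mulr0.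
Qed.

(** Multiplying [f] by a real weight in [[0, 1]] and by its complement keeps the phase, so only
    moduli have to be split. *)
Lemma xcomplex_split f (u v : T -> \bar R) : xmeasurable f ->
  nneg_measurable u -> nneg_measurable v -> (forall x, xmod (f x) <= u x + v x) ->
  exists fA fB, [/\ xmeasurable fA, xmeasurable fB,
    forall x, f x = xadd (fA x) (fB x),
    forall x, xmod (fA x) <= u x & forall x, xmod (fB x) <= v x].
Proof.
move=> mf [mu u0] [mv v0] fuv.
(* If [f x] is infinite, then so is [u x] or [v x], and the weight is 1 or 0. Where [f x] is 0, the
   quotient is 0 by convention, which is harmless. *)
pose theta x : R := if u x == +oo then 1%R else if v x == +oo then 0%R
  else Num.min 1%R (fine (u x) / fine (xmod (f x)))%R.
have mmod := measurable_xmod mf.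
have meq (w : T -> \bar R) : measurable_fun setT w -> measurable_fun setT (fun x => w x
  == +oo).
  move=> mw; apply: (measurable_fun_bool true).
  rewrite (_ : _ @^-1` _ = w @^-1` [set +oo]); first exact: mw.
  by apply/seteqP; split=> x /= /eqP.
have mtheta : measurable_fun setT theta.
  apply: measurable_fun_ifT; [exact: meq|exact: measurable_cst|].
  apply: measurable_fun_ifT; [exact: meq|exact: measurable_cst|].
  apply: measurable_minr => //; apply: measurable_funM.
    exact: measurableT_comp.
  rewrite (_ : (fun x => _) = (fun x => fine (xmod (f x)) `^ (-1))%R); last first.
    by apply/funext => x; rewrite powR_inv1// fine_ge0// xmod_ge0.
  have mfine : measurable_fun setT (fun x => fine (xmod (f x))) by exact: measurableT_comp.
  exact: (measurableT_comp (measurable_powR (-1)%R) mfine).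
have theta0 x : (0 <= theta x)%R.
  rewrite /theta; case: ifP => // _; case: ifP => // _.
  by rewrite le_min ler01 divr_ge0// fine_ge0// xmod_ge0.
have theta1 x : (0 <= 1 - theta x)%R.
  rewrite subr_ge0 /theta; case: ifP => // _; case: ifP => // _.
  by rewrite ge_min lexx.
have fin_case x : u x != +oo -> v x != +oo -> exists p q m : R,
    [/\ u x = p%:E, v x = q%:E, xmod (f x) = m%:E & [/\ 0 <= p, 0 <= q, 0 <= m & m <= p +
      q]%R].
  move: (u0 x) (v0 x) (xmod_ge0 (f x)) (fuv x).
  case: (u x) => [p| |]//; case: (v x) => [q| |]//; case: (xmod (f x)) => [m| |]//.
  by rewrite -EFinD !lee_fin; exists p, q, m.
exists (xscaler theta f), (xscaler (fun x => 1 - theta x)%R f); split.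
- exact: xscaler_xmeasurable.
- by apply: xscaler_xmeasurable => //; exact: measurable_funB.
- by move=> x; rewrite xadd_xscaler.
- move=> x; rewrite xmod_xscaler// /theta; case: eqP => [->|/eqP uoo]; first by rewrite
  leey.
  case: eqP => [_|/eqP voo]; first by rewrite mul0e.
  have [p [q [m [-> _ -> [p0 q0 m0 mpq]]]]] := fin_case x uoo voo.
  rewrite /= -EFinM lee_fin.
  have [->|mN0] := eqVneq m 0%R; first by rewrite mulr0.
  apply: (@le_trans _ _ (p / m * m)%R); last by rewrite divfK.
  by rewrite ler_wpM2r// ge_min lexx orbT.
- move=> x; rewrite xmod_xscaler// /theta; case: eqP => [_|/eqP uoo]; first by rewrite
  subrr mul0e.
  case: eqP => [->|/eqP voo]; first by rewrite leey.
  have [p [q [m [-> -> -> [p0 q0 m0 mpq]]]]] := fin_case x uoo voo.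
  rewrite /= -EFinM lee_fin.
  have [->|mN0] := eqVneq m 0%R; first by rewrite mulr0.
  rewrite minEle; case: ifP => _; first by rewrite subrr mul0r.
  by rewrite mulrBl mul1r divfK// lerBlDl.
Qed.

End splitting.

Section sum_norm.
Context (R : realType) d1 d2 (T1 : measurableType d1) (T2 : measurableType d2).
Variables (mu1 : {measure set T1 -> \bar R}) (mu2 : {measure set T2 -> \bar R}).
Local Open Scope ereal_scope.

Lemma excess_scale (c s : R) (r : \bar R) : (0 < c)%R ->
  excess s (c%:E * r) = c%:E * excess (s / c) r.
Proof.
move=> c0; rewrite /excess maxe_pMr//; last by rewrite lee_fin ltW.
rewrite mule0 muleBr ?fin_num_adde_defl// -EFinM.
by rewrite mulrCA divff ?mulr1// gt_eqF.
Qed.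

Lemma submajorized_scale (c : R) (u1 : T1 -> \bar R) (u2 : T2 -> \bar R) : (0 < c)%R ->
  nneg_measurable u1 -> nneg_measurable u2 -> submajorized mu2 mu1 u2 u1 ->
  submajorized mu2 mu1 (fun y => c%:E * u2 y) (fun x => c%:E * u1 x).
Proof.
move=> c0 [m1 _] [m2 _] sub s s0.
under eq_integral do rewrite excess_scale//.
under [leRHS]eq_integral do rewrite excess_scale//.
rewrite !ge0_integralZl_EFin ?(ltW c0)//; try by move=> *; exact: excess_ge0.
- by rewrite lee_pmul2l ?lte_fin// sub// divr_ge0// ltW.
- exact: measurable_excess.
- exact: measurable_excess.
Qed.

Lemma le_expR_mul (x : \bar R) (r : R) : (0 <= r)%R ->
  (forall delta : R, (0 < delta)%R -> x <= (expR delta)%:E * r%:E) -> x <= r%:E.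
Proof.
move=> r0 H; apply/lee_addgt0Pr => eps eps0.
have r1 : (0 < r + 1)%R by lra.
have q0 : (0 < eps / (r + 1))%R by rewrite divr_gt0.
(* With this [delta] the factor is [1 + eps / (r + 1)], whose excess over 1 costs at most [eps];
   [r + 1] avoids dividing by zero. *)
apply: (le_trans (H (ln (1 + eps / (r + 1))) _)); first by rewrite ln_gt0// ltrDl.
rewrite lnK ?posrE ?addr_gt0// -EFinM -EFinD lee_fin mulrDl mul1r lerD2l.
by rewrite mulrAC ler_pdivrMr// ler_pM2l//; lra.
Qed.

Variables (N1A N1B : (T1 -> xcomplex R) -> \bar R) (N2A N2B : (T2 -> xcomplex R) -> \bar R).

(** The Hardy-Littlewood-Polya principle across two spaces. The factor [c] is built in because the
    transfer of a decomposition loses [expR delta]. *)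
Definition dominates (N2 : (T2 -> xcomplex R) -> \bar R) (N1 : (T1 -> xcomplex R) -> \bar
  R) :=
  forall (c : R) g1 g2, (0 < c)%R -> xmeasurable g1 -> xmeasurable g2 ->
    submajorized mu2 mu1 (fun y => xmod (g2 y)) (fun x => c%:E * xmod (g1 x)) ->
    N2 g2 <= c%:E * N1 g1.

Hypothesis N1A_ge0 : forall g, xmeasurable g -> 0 <= N1A g.
Hypothesis N1B_ge0 : forall g, xmeasurable g -> 0 <= N1B g.
Hypothesis domA : dominates N2A N1A.
Hypothesis domB : dominates N2B N1B.

(** Stated for any two equimeasurable functions on two spaces, so that it yields both inequalities
    of the theorem. *)
Lemma le_sum_norm (f1 : T1 -> xcomplex R) (f2 : T2 -> xcomplex R) :
  xmeasurable f1 -> xmeasurable f2 ->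
  (forall s : R, (0 <= s)%R ->
    mu1 [set x | s%:E < xmod (f1 x)] = mu2 [set y | s%:E < xmod (f2 y)]) ->
  sum_norm mu2 N2A N2B f2 <= sum_norm mu1 N1A N1B f1.
Proof.
move=> mf1 mf2 eq12; apply: le_ereal_inf_tmp => _ [fA [fB [[mfA NfA] [mfB NfB] fE ->]]].
have [a aE] : exists a : R, N1A fA = a%:E.
  by case: (N1A fA) (N1A_ge0 mfA) NfA => // a; exists a.
have [b bE] : exists b : R, N1B fB = b%:E.
  by case: (N1B fB) (N1B_ge0 mfB) NfB => // b; exists b.
have a0 : (0 <= a)%R by rewrite -lee_fin -aE N1A_ge0.
have b0 : (0 <= b)%R by rewrite -lee_fin -bE N1B_ge0.
rewrite aE bE -EFinD; apply: le_expR_mul => [|delta delta0]; first exact: addr_ge0.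
have [A [mA A0 subA]] := fE.
(* The value [+oo] on the null set where the decomposition may fail makes the bound on [|f1|] hold
   everywhere without changing any integral. *)
pose raise (g : T1 -> xcomplex R) x := if x \in A then +oo else xmod (g x).
have m_raise g : xmeasurable g -> nneg_measurable (raise g).
  move=> mg; split; last by move=> x; rewrite /raise; case: ifP => // _; exact: xmod_ge0.
  apply: measurable_fun_ifT; [|exact: measurable_cst|exact: measurable_xmod].
  apply: (measurable_fun_bool true); rewrite setTI (_ : _ @^-1` _ = A)//.
  by apply/seteqP; split=> x /= => [/set_mem|/mem_set].
have raiseE g s : xmeasurable g ->
    \int[mu1]_x excess s (raise g x) = \int[mu1]_x excess s (xmod (g x)).
  move=> mg; apply: ge0_ae_eq_integral => //.
  - by apply: measurable_excess; exact: (m_raise g mg).1.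
  - by apply: measurable_excess; exact: measurable_xmod.
  - by move=> x _; exact: excess_ge0.
  - by move=> x _; exact: excess_ge0.
  exists A; split => // x /= H; apply: contrapT => Ax; apply: H => _.
  by rewrite /raise memNset.
have f1_le x : xmod (f1 x) <= raise fA x + raise fB x.
  rewrite /raise; case: ifPn => Ax; first by rewrite addye ?leey.
  have -> : f1 x = xadd (fA x) (fB x).
    by apply: contrapT => fx; move: Ax; rewrite mem_set//; exact: subA.
  exact: xmod_add.
have [G [H [mG mH f2_le subG subH]]] := submajorized_decomposition
  (xmod_nneg_measurable mf1) (m_raise fA mfA) (m_raise fB mfB)
  (xmod_nneg_measurable mf2) eq12 f1_le delta0.
have c0 := expR_gt0 delta; set c := expR delta in c0 f2_le *.
have mZ w : nneg_measurable w -> nneg_measurable (fun y : T2 => c%:E * w y).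
  by move=> [mw w0]; split=> [|y]; [exact: measurable_funeM|rewrite mule_ge0// lee_fin ltW].
have [|gA [gB [mgA mgB gE leA leB]]] := xcomplex_split mf2 (mZ _ mG) (mZ _ mH).
  by move=> y; rewrite -ge0_muleDr ?f2_le//; [exact: mG.2|exact: mH.2].
have sub_c g h w : xmeasurable g -> xmeasurable h -> nneg_measurable w ->
    (forall y, xmod (h y) <= c%:E * w y) -> submajorized mu2 mu1 w (raise g) ->
    submajorized mu2 mu1 (fun y => xmod (h y)) (fun x => c%:E * xmod (g x)).
  move=> mg mh mw hw subw s s0.
  apply: (@le_trans _ _ (\int[mu2]_y excess s (c%:E * w y))).
    apply: ge0_le_integral => //.
    - by move=> y _; exact: excess_ge0.
    - by apply: measurable_excess; exact: measurable_xmod.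
    - by apply: measurable_excess; exact: (mZ _ mw).1.
    - by move=> y _; exact: le_excess.
  apply: (@le_trans _ _ (\int[mu1]_x excess s (c%:E * raise g x))).
    exact: submajorized_scale (m_raise g mg) mw subw _ s0.
  under eq_integral do rewrite excess_scale//.
  under [leRHS]eq_integral do rewrite excess_scale//.
  rewrite !ge0_integralZl_EFin ?(ltW c0)//; try by move=> *; exact: excess_ge0.
  - by rewrite raiseE.
  - by apply: measurable_excess; exact: measurable_xmod.
  - by apply: measurable_excess; exact: (m_raise g mg).1.
have NgA : N2A gA <= c%:E * a%:E by rewrite -aE; apply: domA => //; exact: sub_c leA subG.
have NgB : N2B gB <= c%:E * b%:E by rewrite -bE; apply: domB => //; exact: sub_c leB subH.
rewrite EFinD ge0_muleDr ?lee_fin//; apply: le_trans (leeD NgA NgB).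
apply: ereal_inf_lbound; exists gA, gB; split => //.
- by split => //; apply: (le_lt_trans NgA); rewrite -EFinM ltry.
- by split => //; apply: (le_lt_trans NgB); rewrite -EFinM ltry.
- by apply: aeW => y; exact: gE.
Qed.

End sum_norm.

(** * Domination between a norm and its canonical representation, both ways *)

Section domination.
Context d (T : measurableType d) (R : realType) (mu : {measure set T -> \bar R}).
Variables (N : (T -> xcomplex R) -> \bar R) (Nbar : (measurableTypeR R -> xcomplex R) ->
  \bar R).
Hypothesis mu_sigma_finite : sigma_finite setT mu.
Hypothesis N_ri : is_ri_norm mu N.
Hypothesis N_Nbar : is_canonical_norm mu N Nbar.
Local Open Scope ereal_scope.
Local Notation Hm := (halfline_measure R).

Lemma canonical_norm_ge0 g : xmeasurable g -> 0 <= Nbar g.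
Proof.
have [Phi [Phi0 _ NbarE _]] := canonical_norm_profile N_ri N_Nbar.
by move=> mg; rewrite NbarE// Phi0//; exact: rearr_profile.
Qed.

Lemma ri_scale_xmod (c : R) f : (0 <= c)%R -> xmeasurable f ->
  N (of_nneg (fun x => c%:E * xmod (f x))) = c%:E * N f.
Proof.
move=> c0 mf; rewrite (ri_scale_nneg N_ri c0 (xmod_nneg_measurable mf)).
by rewrite (ri_abs N_ri mf).
Qed.

Lemma nneg_measurable_scale (c : R) d' (T' : measurableType d') (f : T' -> xcomplex R) :
  (0 <= c)%R -> xmeasurable f -> nneg_measurable (fun x => c%:E * xmod (f x)).
Proof.
move=> c0 mf; split; first by apply: measurable_funeM; exact: measurable_xmod.
by move=> x; rewrite mule_ge0// ?lee_fin// xmod_ge0.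
Qed.

Lemma canonical_dominated : dominates mu Hm Nbar N.
Proof.
move=> c g1 g2 c0 mg1 mg2 sub.
have [Phi [_ NE NbarE mono]] := canonical_norm_profile N_ri N_Nbar.
have mcg := nneg_measurable_scale (ltW c0) mg1.
rewrite -ri_scale_xmod ?(ltW c0)// NE; last exact: of_nneg_xmeasurable.
rewrite NbarE//; apply: mono; [exact: rearr_profile| |].
  by apply: rearr_profile; exact: of_nneg_xmeasurable.
move=> t t0; apply: rearr_submajorized => //; first exact: halfline_sigma_finite.
  exact: of_nneg_xmeasurable.
move=> s s0; under [leRHS]eq_integral do rewrite xmod_of_nneg//.
exact: sub.
Qed.

(** Homogeneity is an axiom for [N] only, so the factor [c] on the side of [Nbar] is moved over to
    [N] as [c^-1]. *)
Lemma canonical_dominates : dominates Hm mu N Nbar.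
Proof.
move=> c g1 g2 c0 mg1 mg2 sub.
have [Phi [_ NE NbarE mono]] := canonical_norm_profile N_ri N_Nbar.
have cV0 : (0 < c^-1)%R by rewrite invr_gt0.
have mcg := nneg_measurable_scale (ltW cV0) mg2.
rewrite -lee_pdivrMl// -ri_scale_xmod ?(ltW cV0)// NE; last exact: of_nneg_xmeasurable.
rewrite NbarE//; apply: mono; [|exact: rearr_profile|].
  by apply: rearr_profile; exact: of_nneg_xmeasurable.
move=> t t0; apply: rearr_submajorized => //; first exact: halfline_sigma_finite.
  exact: of_nneg_xmeasurable.
move=> s s0; under eq_integral do rewrite xmod_of_nneg//.
have := submajorized_scale cV0 (nneg_measurable_scale (ltW c0) mg1) (xmod_nneg_measurable
  mg2) sub s0.
congr (_ <= _); apply: eq_integral => x _.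
by rewrite muleA -EFinM mulVf ?mul1e// gt_eqF.
Qed.

End domination.

Theorem theorem2p4 (R : realType) (d : measure_display) (T : measurableType d)
  (mu : {measure set T -> \bar R})
  (NA NB : (T -> xcomplex R) -> \bar R)
  (NAbar NBbar : (measurableTypeR R -> xcomplex R) -> \bar R)
  (mu_resonant : resonant mu)
  (NA_ri : is_ri_norm mu NA) (NB_ri : is_ri_norm mu NB)
  (NAbar_can : is_canonical_norm mu NA NAbar)
  (NBbar_can : is_canonical_norm mu NB NBbar)
  (f : T -> xcomplex R) (f_meas : xmeasurable f) :
  sum_norm mu NA NB f =
  sum_norm (halfline_measure R) NAbar NBbar (of_nneg (rearr mu f)).
Proof.
have [mu_sf _] := mu_resonant.
have mr := rearr_nneg_measurable mu f_meas.
have equi (s : R) : 0 <= s -> (mu [set x | s%:E < xmod (f x)] =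
    halfline_measure R [set t | s%:E < xmod (of_nneg (rearr mu f) t)])%E.
  move=> s0; under [in RHS]eq_set do rewrite (xmod_of_nneg _ mr).
  by rewrite rearr_equimeasurable.
apply/eqP; rewrite eq_le; apply/andP; split.
- apply: le_sum_norm => //.
  + exact: canonical_norm_ge0 NA_ri NAbar_can.
  + exact: canonical_norm_ge0 NB_ri NBbar_can.
  + exact: canonical_dominates.
  + exact: canonical_dominates.
  + exact: of_nneg_xmeasurable.
  + by move=> s s0; rewrite equi.
- apply: le_sum_norm => //.
  + exact: ri_ge0 NA_ri.
  + exact: ri_ge0 NB_ri.
  + exact: canonical_dominated.
  + exact: canonical_dominated.
  + exact: of_nneg_xmeasurable.
Qed.
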